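(* Let $d, N$ be positive integers and let $\mathcal A = (A_1, \dotsc, A_N) \in \mathcal M_d(\mathbb R)^N$. Then $\mathcal A$ has the finiteness property if and only if there exists a positive integer $m$ such that $\rho_{\mathrm d}(\mathcal A) = \rho_{\mathrm p}(m, \mathcal A)$.
   Context: $\mathcal M_d(\mathbb R)$ is the space of $d\times d$ real matrices; $\rho(M)$ is the spectral radius of $M$; $\|\cdot\|$ is any norm on $\mathcal M_d(\mathbb R)$ induced by a norm on $\mathbb R^d$ (the quantities below do not depend on this choice). The deterministic joint spectral radius is $$\rho_{\mathrm d}(\mathcal A) = \limsup_{n\to\infty} \max_{(i_1,\dotsc,i_n)\in\{1,\dotsc,N\}^n} \|A_{i_n}\dotsm A_{i_1}\|^{1/n}.$$ $\mathcal A$ has the finiteness property if there exist $k\ge1$ and $i_1,\dotsc,i_k\in\{1,\dotsc,N\}$ such that $\rho_{\mathrm d}(\mathcal A) = \rho(A_{i_k}\dotsm A_{i_1})^{1/k}$. Markov chains of order $m\ge 1$ on $\{1,\dotsc,N\}$: a stochastic tensor of order $m+1$ is a family of nonnegative reals $P = (P_{i_1\dotso i_{m+1}})_{i_1,\dotsc,i_{m+1}\in\{1,\dotsc,N\}}$ with $\sum_{i_{m+1}=1}^N P_{i_1\dotso i_m i_{m+1}} = 1$ for all $(i_1,\dotsc,i_m)$. A probability tensor of order $m$ is a family of nonnegative reals $\nu = (\nu_{i_1\dotso i_m})$ with $\sum_{(i_1,\dotsc,i_m)} \nu_{i_1\dotso i_m} = 1$; it is invariant under $P$ (an invariant probability tensor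 for $P$) if $\sum_{i_1=1}^N \nu_{i_1\dotso i_m} P_{i_1\dotso i_{m+1}} = \nu_{i_2\dotso i_{m+1}}$ for all $(i_2,\dotsc,i_{m+1})\in\{1,\dotsc,N\}^m$. For such a pair, $$\rho_{\mathrm p}(\nu,P,\mathcal A) = \limsup_{n\to\infty} \mathbb E_{(\nu,P)}\left[\|A_{i_n}\dotsm A_{i_1}\|^{1/n}\right],$$ where, for $n\ge m$, $$\mathbb E_{(\nu,P)}\left[\|A_{i_n}\dotsm A_{i_1}\|^{1/n}\right] = \sum_{(i_1,\dotsc,i_n)\in\{1,\dotsc,N\}^n} \nu_{i_1\dotso i_m} \Bigl(\prod_{j=1}^{n-m} P_{i_j i_{j+1}\dotso i_{j+m}}\Bigr) \|A_{i_n}\dotsm A_{i_1}\|^{1/n}.$$ Finally, $\rho_{\mathrm p}(m,\mathcal A)$ is the supremum of $\rho_{\mathrm p}(\nu,P,\mathcal A)$ over all pairs $(\nu,P)$ with $P$ a stochastic tensor of order $m+1$ and $\nu$ an invariant probability tensor (of order $m$) for $P$. *)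

(* Defs.v *)
From HB Require Import structures.
From mathcomp Require Import all_boot all_order all_algebra.
From mathcomp Require Import complex.
From mathcomp Require Import all_classical all_reals all_analysis.
Set Implicit Arguments.
Unset Strict Implicit.
Unset Printing Implicit Defensive.
Import Order.TTheory GRing.Theory Num.Theory.
Local Open Scope classical_set_scope.
Local Open Scope ring_scope.

Record is_vector_norm (R : realType) (d : nat) (nrm : 'cV[R]_d -> R) : Prop :=
  IsVectorNorm {
    vnorm_ge0 : forall x, 0 <= nrm x ;
    vnorm_eq0 : forall x, nrm x = 0 -> x = 0 ;
    vnormZ : forall (a : R) x, nrm (a *: x) = `|a| * nrm x ;
    vnormD : forall x y, nrm (x + y) <= nrm x + nrm y }.

Definition induced_norm (R : realType) (d : nat) (nrm : 'cV[R]_d -> R)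
    (M : 'M[R]_d) : R :=
  sup [set nrm (M *m x) | x in [set x | nrm x <= 1]].

(* [eigenvalue] is defined through row eigenvectors; the eigenvalues are the
   same as those for column eigenvectors. *)
Definition spectral_radius (R : realType) (d : nat) (M : 'M[R]_d) : R :=
  sup [set ComplexField.Normc.normc z | z in
        [set z : R[i] | eigenvalue (map_mx (real_complex R) M) z]].

(* The later factors go to the left:
   [word_mx A [:: i_1; ...; i_n]] is [A i_n *m ... *m A i_1]. *)
Definition word_mx (R : realType) (d N : nat) (A : 'I_N -> 'M[R]_d)
    (s : seq 'I_N) : 'M[R]_d :=
  foldl (fun M i => A i *m M) 1%:M s.

Definition word_rate (R : realType) (d N : nat) (nrm : 'cV[R]_d -> R)
    (A : 'I_N -> 'M[R]_d) (s : seq 'I_N) : R :=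
  induced_norm nrm (word_mx A s) `^ (size s)%:R^-1.

(* All rates are nonnegative, so the default value 0 of the maximum is
   harmless. *)
Definition rho_d (R : realType) (d N : nat) (nrm : 'cV[R]_d -> R)
    (A : 'I_N -> 'M[R]_d) : R :=
  limn_sup (fun n => \big[Num.max/0]_(t : n.-tuple 'I_N) word_rate nrm A t).

Definition finiteness_property (R : realType) (d N : nat)
    (nrm : 'cV[R]_d -> R) (A : 'I_N -> 'M[R]_d) : Prop :=
  exists k : nat, (0 < k)%N /\
    exists t : k.-tuple 'I_N,
      rho_d nrm A = spectral_radius (word_mx A t) `^ k%:R^-1.

Definition stochastic_tensor (R : realType) (N m : nat)
    (P : m.+1.-tuple 'I_N -> R) : Prop :=
  (forall w, 0 <= P w) /\
  (forall w : m.-tuple 'I_N, \sum_(i < N) P [tuple of rcons w i] = 1).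

Definition probability_tensor (R : realType) (N m : nat)
    (nu : m.-tuple 'I_N -> R) : Prop :=
  (forall w, 0 <= nu w) /\ \sum_(w : m.-tuple 'I_N) nu w = 1.

(* With [i = i_1] and [w = (i_2, ..., i_(m+1))], [belast i w] is
   [(i_1, ..., i_m)] and [i :: w] is [(i_1, ..., i_(m+1))]. *)
Definition invariant_tensor (R : realType) (N m : nat)
    (nu : m.-tuple 'I_N -> R) (P : m.+1.-tuple 'I_N -> R) : Prop :=
  forall w : m.-tuple 'I_N,
    \sum_(i < N) nu [tuple of belast i w] * P [tuple of i :: w] = nu w.

(* The value of a tensor of order [k] at a word, with junk value 0 when the
   word does not have length [k]. *)
Definition tensor_at (R : realType) (N k : nat) (T : k.-tuple 'I_N -> R)
    (s : seq 'I_N) : R :=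
  if insub s is Some w then T w else 0.

(* Only meaningful for [m <= n]: the words [take m t] and
   [take m.+1 (drop j t)], [j < n - m], then have lengths [m] and [m.+1]. *)
Definition markov_expectation (R : realType) (d N m : nat)
    (nrm : 'cV[R]_d -> R) (nu : m.-tuple 'I_N -> R)
    (P : m.+1.-tuple 'I_N -> R) (A : 'I_N -> 'M[R]_d) (n : nat) : R :=
  \sum_(t : n.-tuple 'I_N)
     tensor_at nu (take m t) *
     (\prod_(j < n - m) tensor_at P (take m.+1 (drop j t))) *
     word_rate nrm A t.

Definition rho_p_pair (R : realType) (d N m : nat) (nrm : 'cV[R]_d -> R)
    (nu : m.-tuple 'I_N -> R) (P : m.+1.-tuple 'I_N -> R)
    (A : 'I_N -> 'M[R]_d) : R :=
  limn_sup (markov_expectation nrm nu P A).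

Definition rho_p (R : realType) (d N : nat) (nrm : 'cV[R]_d -> R) (m : nat)
    (A : 'I_N -> 'M[R]_d) : R :=
  sup [set r : R | exists (nu : m.-tuple 'I_N -> R)
                          (P : m.+1.-tuple 'I_N -> R),
        [/\ stochastic_tensor P, probability_tensor nu, invariant_tensor nu P
          & r = rho_p_pair nrm nu P A]].

(* Main.v *)
(* If the word [t] of length [k] realizes [rho_d], the Markov chain of order [k]
   that repeats [t] periodically, started from a uniformly chosen rotation of
   [t], has [rho_p] equal to [rho_d]: the rotations of [t] have products with
   the same nonzero eigenvalues.

   Conversely, suppose that [rho_d] is positive, normalized to [1], and that the
   product of every nonempty word has spectral radius [< 1], so that its powers
   tend to [0].  Then the expected norm of the random product decays
   geometrically, at a rate that is uniform over all Markov chains of order [m].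
   This is proved by induction on the dimension.  The row vectors with bounded
   orbit form an invariant subspace, which is nonzero by compactness because
   [rho_d = 1].  If it is proper, the matrices are block triangular.  If it is
   everything, there is a norm for which the products are nonexpansive, and from
   every state the chain reads, with probability bounded below, a high power of
   a cycle, whose product is a contraction.  By concavity of the [n]-th root,
   [rho_p] is then bounded by a constant [< rho_d]. *)
Require Import Defs.
From mathcomp Require Import all_boot all_order all_algebra.
From mathcomp Require Import complex.
From mathcomp Require Import all_classical all_reals all_analysis.
From mathcomp Require Import ring lra.
Set Implicit Arguments.
Unset Strict Implicit.
Unset Printing Implicit Defensive.
Import Order.TTheory GRing.Theory Num.Theory.
Import numFieldNormedType.Exports.
Local Open Scope classical_set_scope.
Local Open Scope ring_scope.

(** * Limits superior of bounded real sequences *)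

Section LimnSup.
Context {R : realType}.
Implicit Types (u v : R^nat) (a b : R).

(** Boundedness makes the real-valued [limn_sup] the infimum of the suprema of the tails. *)
Lemma limn_sup_le u b a (n0 : nat) : (forall n, `|u n| <= b) ->
  (forall n, (n0 <= n)%N -> u n <= a) -> limn_sup u <= a.
Proof.
move=> ub ua.
have bu : bounded_fun (u : R^o^nat).
  exists b; split; first exact: num_real.
  by move=> x bx n _ /=; exact: le_trans (ub n) (ltW bx).
rewrite limn_supE//; apply: (@le_trans _ _ (sups u n0)).
  apply: ge_inf; last by exists n0.
  exists (- b) => _ [n _ <-]; apply: (@le_trans _ _ (u n)).
    by have := ub n; rewrite ler_norml => /andP[].
  apply: ub_le_sup; last by exists n => /=.
  exists b => _ [k _ <-]; exact: le_trans (ler_norm _) (ub k).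
apply: ge_sup; first by exists (u n0); exists n0 => /=.
by move=> _ [n /= n0n <-]; exact: ua.
Qed.

Lemma limn_sup_ge u b a : (forall n, `|u n| <= b) ->
  (forall n0, exists2 n, (n0 <= n)%N & a <= u n) -> a <= limn_sup u.
Proof.
move=> ub ua.
have bu : bounded_fun (u : R^o^nat).
  exists b; split; first exact: num_real.
  by move=> x bx n _ /=; exact: le_trans (ub n) (ltW bx).
rewrite limn_supE//; apply: lb_le_inf; first by exists (sups u 0); exists 0%N.
move=> _ [n0 _ <-]; have [n n0n aun] := ua n0.
apply: le_trans aun _; apply: ub_le_sup; last by exists n.
exists b => _ [k _ <-]; exact: le_trans (ler_norm _) (ub k).
Qed.

Lemma limn_sup_lt u b a : (forall n, `|u n| <= b) -> limn_sup u < a ->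
  exists n0, forall n, (n0 <= n)%N -> u n < a.
Proof.
move=> ub; apply: contraPP => /forallNP nu; apply/negP; rewrite -leNgt.
apply: limn_sup_ge ub _ => n0; have /existsNP[n /not_implyP[n0n /negP]] := nu n0.
by rewrite -leNgt => aun; exists n.
Qed.

Lemma le_limn_sup u v b (n0 : nat) : (forall n, `|u n| <= b) ->
  (forall n, `|v n| <= b) -> (forall n, (n0 <= n)%N -> u n <= v n) ->
  limn_sup u <= limn_sup v.
Proof.
move=> ub vb uv; apply/ler_addgt0Pr => e e0.
have [n1 vn1] : exists n1, forall n, (n1 <= n)%N -> v n < limn_sup v + e.
  by apply: limn_sup_lt vb _; rewrite ltrDl.
apply: (limn_sup_le (n0 := maxn n0 n1) ub) => n; rewrite geq_max => /andP[n0n n1n].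
exact: le_trans (uv _ n0n) (ltW (vn1 _ n1n)).
Qed.

End LimnSup.

(* [y `^ n^-1] lies below the tangent at [1], by Bernoulli's inequality. *)
Lemma powR_inv_le (R : realType) (y : R) (n : nat) : 0 <= y -> (0 < n)%N ->
  y `^ n%:R^-1 <= 1 + (y - 1) / n%:R.
Proof.
move=> y0 n0; have nR : 0 < n%:R :> R by rewrite ltr0n.
have n1 : (n%:R : R)^-1 <= 1 by rewrite invf_le1// ler1n.
have h : -1 <= (y - 1) / n%:R.
  have ni : 0 < (n%:R : R)^-1 by rewrite invr_gt0.
  rewrite mulrBl mul1r; have := mulr_ge0 y0 (ltW ni); lra.
have bern m : 1 + m%:R * ((y - 1) / n%:R) <= (1 + (y - 1) / n%:R) ^+ m.
  move: ((y - 1) / n%:R) h => x hx; elim: m => [|m IH].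
    by rewrite mul0r addr0 expr0.
  case: m IH => [_|m IH]; first by rewrite expr1 mul1r.
  rewrite exprS; apply: le_trans (ler_wpM2l _ IH); last lra.
  rewrite -[m.+2%:R]natr1.
  have : 0 <= m.+1%:R * x ^+ 2 by rewrite mulr_ge0// sqr_ge0.
  nra.
have {bern} := bern n; rewrite mulrCA divff ?gt_eqF// mulr1 addrC subrK => bern.
have x0 : 0 <= 1 + (y - 1) / n%:R by lra.
apply: le_trans (ge0_ler_powR _ _ _ bern) _; rewrite ?nnegrE ?exprn_ge0//.
by rewrite -powR_mulrn// -powRrM divff ?gt_eqF// powRr1.
Qed.

Lemma powR_inv_cvg1 (R : realType) (c e : R) : 0 < c -> 0 < e ->
  exists n0, forall n, (n0 <= n)%N -> (0 < n)%N /\ c `^ n%:R^-1 <= 1 + e.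
Proof.
move=> c0 e0; have [k ck] : exists k : nat, `|c - 1| / e < k%:R.
  by exists (Num.truncn (`|c - 1| / e)).+1; rewrite truncnS_gt.
exists k.+1 => n kn; have n0 : (0 < n)%N by apply: leq_trans kn.
split=> //; apply: le_trans (powR_inv_le (ltW c0) n0) _.
rewrite lerD2l ler_pdivrMr ?ltr0n//.
apply: le_trans (ler_norm _) _; rewrite mulrC -ler_pdivrMr//.
by apply: le_trans (ltW ck) _; rewrite ler_nat ltnW.
Qed.

(** Inverts the upper estimate for [c^-1], since 1 / (1 + e) >= 1 - e. *)
Lemma powR_inv_cvg1_lower (R : realType) (c e : R) : 0 < c -> 0 < e ->
  exists n0, forall n, (n0 <= n)%N -> (0 < n)%N /\ 1 - e <= c `^ n%:R^-1.
Proof.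
move=> c0 e0; have ci0 : 0 < c^-1 by rewrite invr_gt0.
have [n0 h] := powR_inv_cvg1 ci0 e0.
exists n0 => n /h[npos ce]; split => //.
have cp : 0 < c `^ n%:R^-1 by exact: powR_gt0.
have : (c `^ n%:R^-1)^-1 <= 1 + e.
  by rewrite -powR_inv1 ?powR_ge0// -powRrM mulrC powRrM powR_inv1// ltW.
rewrite -(ler_pM2l cp) divff ?gt_eqF//.
move: (c `^ _) cp => x x0 hx.
have := ler_wpM2l (ltW x0) hx.
nra.
Qed.

(** * The entrywise sum norm of rectangular matrices *)

Section EntrySumNorm.
Context {K : numDomainType}.

(** This norm is submultiplicative for all matrix shapes and adds up over rows. The base is a
    [numDomainType] so that it also serves for complex row eigenvectors. *)
Definition norm1 m n (M : 'M[K]_(m, n)) : K := \sum_i \sum_j `|M i j|.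

Lemma norm1_ge0 m n (M : 'M[K]_(m, n)) : 0 <= norm1 M.
Proof. by apply: sumr_ge0 => i _; apply: sumr_ge0. Qed.

Lemma norm1_0 m n : norm1 (0 : 'M[K]_(m, n)) = 0.
Proof. by rewrite /norm1 big1// => i _; rewrite big1// => j _; rewrite mxE normr0. Qed.

Lemma norm1_entry m n (M : 'M[K]_(m, n)) i j : `|M i j| <= norm1 M.
Proof.
rewrite /norm1 (bigD1 i)//= (bigD1 j)//= -addrA lerDl addr_ge0//.
  exact: sumr_ge0.
by apply: sumr_ge0 => k _; exact: sumr_ge0.
Qed.

Lemma norm1_eq0 m n (M : 'M[K]_(m, n)) : norm1 M = 0 -> M = 0.
Proof.
move=> M0; apply/matrixP => i j; rewrite mxE; apply/eqP; rewrite -normr_le0 -M0.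
exact: norm1_entry.
Qed.

Lemma norm1D m n (M M' : 'M[K]_(m, n)) : norm1 (M + M') <= norm1 M + norm1 M'.
Proof.
rewrite /norm1 -big_split/=; apply: ler_sum => i _; rewrite -big_split/=.
by apply: ler_sum => j _; rewrite mxE ler_normD.
Qed.

Lemma norm1B m n (M M' : 'M[K]_(m, n)) : norm1 M - norm1 M' <= norm1 (M - M').
Proof. by rewrite lerBlDr -{1}(subrK M' M) norm1D. Qed.

Lemma norm1Z m n (a : K) (M : 'M[K]_(m, n)) : norm1 (a *: M) = `|a| * norm1 M.
Proof.
rewrite /norm1 mulr_sumr; apply: eq_bigr => i _; rewrite mulr_sumr.
by apply: eq_bigr => j _; rewrite mxE normrM.
Qed.

Lemma norm1M m n p (M : 'M[K]_(m, n)) (M' : 'M[K]_(n, p)) :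
  norm1 (M *m M') <= norm1 M * norm1 M'.
Proof.
rewrite /norm1 mulr_suml; apply: ler_sum => i _.
apply: (@le_trans _ _ (\sum_j \sum_k `|M i k| * `|M' k j|)).
  apply: ler_sum => j _; rewrite mxE; apply: le_trans (ler_norm_sum _ _ _) _.
  by apply: ler_sum => k _; rewrite normrM.
rewrite exchange_big/= mulr_suml; apply: ler_sum => k _; rewrite -mulr_sumr.
apply: ler_wpM2l => //; rewrite (bigD1 k)//= lerDl.
by apply: sumr_ge0 => l _; exact: sumr_ge0.
Qed.

Lemma norm1_tr m n (M : 'M[K]_(m, n)) : norm1 M^T = norm1 M.
Proof.
by rewrite /norm1 exchange_big/=; apply: eq_bigr => i _; apply: eq_bigr => j _; rewrite mxE.
Qed.

Lemma norm1_row m n (M : 'M[K]_(m, n)) : norm1 M = \sum_i norm1 (row i M).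
Proof.
apply: eq_bigr => i _; rewrite /norm1 big_ord1.
by apply: eq_bigr => j _; rewrite mxE.
Qed.

End EntrySumNorm.

(** * Compactness of the unit sphere of row vectors *)

Section Compactness.
Context {R : realType}.

Lemma norm1_normalize n (x : 'rV[R]_n) : norm1 x != 0 -> norm1 ((norm1 x)^-1 *: x) = 1.
Proof. by move=> x0; rewrite norm1Z normfV ger0_norm ?norm1_ge0// mulVf. Qed.

Lemma norm1_le_mx_norm n (x : 'rV[R]_n) : norm1 x <= n%:R * `|x|.
Proof.
rewrite /norm1 big_ord1 -[n in n%:R]card_ord mulr_natl -sumr_const.
apply: ler_sum => j _; rewrite /Num.norm/= mx_normrE.
exact: (le_bigmax _ (fun ij : 'I_1 * 'I_n => `|x ij.1 ij.2|) (0, j)).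
Qed.

Lemma mx_norm_le_norm1 n (x : 'rV[R]_n) : `|x| <= norm1 x.
Proof.
rewrite /Num.norm/= mx_normrE; apply: bigmax_le; first exact: norm1_ge0.
by move=> i _; exact: norm1_entry.
Qed.

(** The hypothesis is one-sided because [x] and [y] can be exchanged. The topology comes from the
    maximum norm, whence the factor [n%:R] in the proof. *)
Lemma norm1_lipschitz_continuous n (f : 'rV[R]_n -> R) (L : R) :
  (forall x y, f x - f y <= L * norm1 (x - y)) -> continuous f.
Proof.
move=> fL x; apply/(@cvgrPdist_lt _ R^o _ (nbhs x) (nbhs_filter x)) => e e0.
have L0 : 0 < `|L| * n%:R + 1 by rewrite ltr_wpDl// mulr_ge0.
have fL' a b : f a - f b <= (`|L| * n%:R) * `|a - b|.
  apply: le_trans (fL a b) _; rewrite -mulrA.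
  apply: (@le_trans _ _ (`|L| * norm1 (a - b))).
    by apply: ler_wpM2r; [exact: norm1_ge0|exact: ler_norm].
  by apply: ler_wpM2l => //; exact: norm1_le_mx_norm.
apply/nbhs_ballP; exists (e / (`|L| * n%:R + 1)); first exact: divr_gt0.
move=> y; rewrite mx_norm_ball /ball_/= => xy.
rewrite ltr_pdivlMr// in xy.
have h1 := fL' x y; have h2 := fL' y x; rewrite distrC in h2.
have h0 := normr_ge0 (x - y).
rewrite ltr_norml; apply/andP; split; nra.
Qed.

Lemma norm1_sphere_compact n : compact [set x : 'rV[R]_n | norm1 x = 1].
Proof.
apply: bounded_closed_compact.
  exists 1; split; first exact: num_real.
  by move=> a a1 x /= x1; apply: le_trans (mx_norm_le_norm1 x) _; rewrite x1 ltW.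
have cn : continuous (@norm1 R 1 n).
  by apply: (@norm1_lipschitz_continuous _ _ 1) => x y; rewrite mul1r norm1B.
have -> : [set x : 'rV[R]_n | norm1 x = 1] = (@norm1 R 1 n) @^-1` [set 1] by [].
by apply: preimage_closed => // *; exact: cn.
Qed.

(** A finite subcover by the open sets where [g i] is positive. It serves twice: for the equivalence
    of norms, and to select finitely many words that stretch all unit row vectors. *)
Lemma norm1_sphere_cover n (I : choiceType) (g : I -> 'rV[R]_n -> R) (L : I -> R) :
  (forall i x y, g i x - g i y <= L i * norm1 (x - y)) ->
  (forall x, norm1 x = 1 -> exists i, 0 < g i x) ->
  exists s : seq I, forall x, norm1 x = 1 -> exists2 i, i \in s & 0 < g i x.
Proof.
move=> gL g0; have := @norm1_sphere_compact n; rewrite compact_cover.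
move=> /(_ I setT (fun i => g i @^-1` [set t | 0 < t])).
case.
- move=> i _; apply: open_comp; last exact: open_gt.
  by move=> x _; exact: (norm1_lipschitz_continuous (gL i)).
- by move=> x /= /g0[i gi]; exists i.
move=> D _ cD; exists (finmap.enum_fset D) => x x1.
by have [i /= iD gi] := cD x x1; exists i.
Qed.

End Compactness.

(** * Equivalence of the induced norm with the entrywise sum norm *)

Section InducedNorm.
Context {R : realType} {d : nat} (nrm : 'cV[R]_d -> R).
Hypothesis nrmP : is_vector_norm nrm.

Let vnorm0 : nrm 0 = 0.
Proof. by rewrite -(scale0r 0) (vnormZ nrmP) normr0 mul0r. Qed.

Lemma vnorm_sum (I : finType) (F : I -> 'cV[R]_d) :
  nrm (\sum_i F i) <= \sum_i nrm (F i).
Proof.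
elim/big_ind2 : _ => [|x a y b xa yb|//]; first by rewrite vnorm0.
exact: le_trans (vnormD nrmP _ _) (lerD xa yb).
Qed.

Lemma vnorm_le_norm1 : exists2 c, 0 < c & forall x, nrm x <= c * norm1 x.
Proof.
(* The summand 1 keeps the constant positive in dimension 0. *)
exists (1 + \sum_j nrm (delta_mx j 0)).
  by rewrite ltr_pwDl// sumr_ge0// => j _; exact: (vnorm_ge0 nrmP).
move=> x; have -> : nrm x = nrm (\sum_j x j 0 *: delta_mx j 0).
  by congr nrm; rewrite {1}[x]matrix_sum_delta; apply: eq_bigr => j _; rewrite big_ord1.
apply: le_trans (vnorm_sum _) _; rewrite mulrDl mul1r ler_wpDl ?norm1_ge0//.
rewrite mulr_suml; apply: ler_sum => j _; rewrite (vnormZ nrmP) mulrC.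
by apply: ler_wpM2l; [exact: (vnorm_ge0 nrmP)|exact: norm1_entry].
Qed.

(** The norm has no zero on the unit sphere, so the sets where it exceeds [k.+1%:R^-1] cover the
    sphere; finitely many suffice, and their largest index gives the constant. *)
Lemma norm1_le_vnorm : exists2 c, 0 < c & forall x, norm1 x <= c * nrm x.
Proof.
have [C C0 hC] := vnorm_le_norm1.
pose g (k : nat) (x : 'rV[R]_d) := nrm x^T - k.+1%:R^-1.
have gL k x y : g k x - g k y <= C * norm1 (x - y).
  rewrite /g opprB addrA subrK -[norm1 (x - y)]norm1_tr linearB/=.
  apply: le_trans (hC _); rewrite lerBlDr -{1}(subrK y^T x^T).
  exact: (vnormD nrmP).
have [x x1|s hs] := norm1_sphere_cover gL.
  have x0 : 0 < nrm x^T.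
    rewrite lt_neqAle (vnorm_ge0 nrmP) andbT; apply/eqP => /esym/(vnorm_eq0 nrmP).
    by move=> /(congr1 trmx); rewrite trmxK trmx0 => xx; move: x1; rewrite xx norm1_0; lra.
  exists (Num.truncn (nrm x^T)^-1); rewrite /g subr_gt0.
  by rewrite invf_plt ?posrE ?truncnS_gt// ltr0n.
pose K := (\max_(k <- s) k).+1.
exists K%:R; first by rewrite ltr0n.
move=> x; have [x0|x0] := eqVneq (norm1 x) 0.
  by rewrite x0 mulr_ge0// (vnorm_ge0 nrmP).
pose y := (norm1 x^T)^-1 *: x^T; have nx : norm1 x^T = norm1 x by exact: norm1_tr.
have [k ks] := hs y (norm1_normalize (x := x^T) ltac:(by rewrite nx)).
have xp : 0 < norm1 x by rewrite lt_neqAle eq_sym x0 norm1_ge0.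
rewrite /g /y linearZ/= trmxK (vnormZ nrmP) nx normfV ger0_norm ?norm1_ge0// subr_gt0.
rewrite mulrC ltr_pdivlMr// mulrC ltr_pdivrMr ?ltr0n// => xk.
rewrite mulrC; apply: le_trans (ltW xk) _; apply: ler_wpM2l; first exact: (vnorm_ge0 nrmP).
by rewrite ler_nat ltnS; exact: leq_bigmax_seq.
Qed.

Lemma induced_norm_equiv : exists2 c, 0 < c &
  forall M : 'M[R]_d, induced_norm nrm M <= c * norm1 M /\ norm1 M <= c * induced_norm nrm M.
Proof.
have [C C0 hC] := vnorm_le_norm1; have [D D0 hD] := norm1_le_vnorm.
have ubM M : ubound [set nrm (M *m x) | x in [set x | nrm x <= 1]] (C * D * norm1 M).
  move=> _ [x /= x1 <-]; apply: le_trans (hC _) _; rewrite -mulrA.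
  apply: ler_wpM2l; [exact: ltW|apply: le_trans (norm1M _ _) _; rewrite mulrC].
  apply: ler_wpM2r; [exact: norm1_ge0|apply: le_trans (hD _) _].
  by rewrite -[leRHS]mulr1; apply: ler_wpM2l; [exact: ltW|].
have le1 M : induced_norm nrm M <= C * D * norm1 M.
  apply: ge_sup (ubM M); exists (nrm (M *m 0)), 0 => //=.
  by rewrite vnorm0 ler01.
(* Each column of [M] is the image of a basis vector, which has to be rescaled to enter the unit
   ball of [nrm]. *)
pose E := \sum_(j < d) nrm (delta_mx j 0).
have E0 : 0 <= E by apply: sumr_ge0 => j _; exact: (vnorm_ge0 nrmP).
have le2 M : norm1 M <= D * E * induced_norm nrm M.
  rewrite -norm1_tr norm1_row -mulrA /E mulr_suml mulr_sumr; apply: ler_sum => j _.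
  rewrite -[norm1 _]norm1_tr tr_row trmxK; apply: le_trans (hD _) _.
  apply: ler_wpM2l; first exact: ltW.
  pose e : 'cV[R]_d := delta_mx j 0; have ne0 : 0 < nrm e.
    rewrite lt_neqAle (vnorm_ge0 nrmP) andbT; apply/eqP => /esym/(vnorm_eq0 nrmP).
    by move=> /matrixP/(_ j 0); rewrite !mxE !eqxx => /eqP; rewrite oner_eq0.
  rewrite -/e mulrC -ler_pdivrMr//.
  have -> : nrm (col j M) / nrm e = nrm (M *m ((nrm e)^-1 *: e)).
    by rewrite -scalemxAr (vnormZ nrmP) normfV gtr0_norm// mulrC /e colE.
  apply: ub_le_sup; first by exists (C * D * norm1 M); exact: ubM.
  exists ((nrm e)^-1 *: e) => //=.
  by rewrite (vnormZ nrmP) normfV gtr0_norm// mulVf// gt_eqF.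
exists (C * D + D * E); first by rewrite ltr_pwDl// ?mulr_gt0// mulr_ge0// ltW.
move=> M; have IM : 0 <= induced_norm nrm M.
  have -> : 0 = nrm (M *m 0) by rewrite mulmx0 vnorm0.
  apply: ub_le_sup; first by exists (C * D * norm1 M); exact: ubM.
  by exists 0 => //=; rewrite vnorm0 ler01.
split; [apply: le_trans (le1 M) _|apply: le_trans (le2 M) _].
  by rewrite mulrDl lerDl !mulr_ge0// ?norm1_ge0// ltW.
by rewrite mulrDl lerDr !mulr_ge0// ltW.
Qed.

Lemma induced_norm_ge0 (M : 'M[R]_d) : 0 <= induced_norm nrm M.
Proof.
have [c c0 /(_ M)[_ h]] := induced_norm_equiv.
by rewrite -(pmulr_rge0 _ c0); apply: le_trans h; exact: norm1_ge0.
Qed.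

End InducedNorm.

(** * Products along words *)

Section WordProducts.
Context {R : realType} {N : nat}.

Lemma word_mx_cat d (A : 'I_N -> 'M[R]_d) s t :
  word_mx A (s ++ t) = word_mx A t *m word_mx A s.
Proof.
rewrite /word_mx foldl_cat; elim/last_ind: t => [|t i IH]; first by rewrite mul1mx.
by rewrite !foldl_rcons IH mulmxA.
Qed.

Lemma word_mx1 d (A : 'I_N -> 'M[R]_d) i : word_mx A [:: i] = A i.
Proof. by rewrite /word_mx/= mulmx1. Qed.

Lemma word_mx_cons d (A : 'I_N -> 'M[R]_d) i s :
  word_mx A (i :: s) = word_mx A s *m A i.
Proof. by rewrite -cat1s word_mx_cat word_mx1. Qed.

Lemma word_mx_rcons d (A : 'I_N -> 'M[R]_d) i s :
  word_mx A (rcons s i) = A i *m word_mx A s.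
Proof. by rewrite -cats1 word_mx_cat word_mx1. Qed.

Lemma word_mxZ d (A : 'I_N -> 'M[R]_d) (a : R) s :
  word_mx (fun i => a *: A i) s = a ^+ size s *: word_mx A s.
Proof.
elim: s => [|i s IH]; first by rewrite scale1r.
by rewrite !word_mx_cons IH -scalemxAl -scalemxAr scalerA exprSr.
Qed.

Lemma norm1_word_mx_bound d (A : 'I_N -> 'M[R]_d) : exists2 b, 1 <= b &
  forall s, norm1 (word_mx A s) <= (1 + norm1 (1%:M : 'M[R]_d)) * b ^+ size s.
Proof.
have sA : 0 <= \sum_i norm1 (A i) by apply: sumr_ge0 => i _; exact: norm1_ge0.
exists (1 + \sum_i norm1 (A i)); first by rewrite lerDl.
have n1 := norm1_ge0 (1%:M : 'M[R]_d).
elim=> [|i s IH]; first by rewrite expr0 mulr1 lerDr.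
rewrite word_mx_cons exprSr mulrA; apply: le_trans (norm1M _ _) _.
apply: ler_pM; rewrite ?norm1_ge0//; apply: ler_wpDl => //.
by rewrite (bigD1 i)//= lerDl; apply: sumr_ge0 => k _; exact: norm1_ge0.
Qed.

Definition wpow (s : seq 'I_N) q := flatten (nseq q s).

Lemma size_wpow s q : size (wpow s q) = (q * size s)%N.
Proof. by elim: q => //= q IH; rewrite size_cat IH mulSn. Qed.

End WordProducts.

(** * Boundedness of the rates of words *)

Section WordRate.
Context {R : realType} {d N : nat} (nrm : 'cV[R]_d -> R).
Hypothesis nrmP : is_vector_norm nrm.
Implicit Types A : 'I_N -> 'M[R]_d.

Lemma word_rate_ge0 A s : 0 <= word_rate nrm A s.
Proof. exact: powR_ge0. Qed.

Lemma word_rate_bound A : exists b, forall s, word_rate nrm A s <= b.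
Proof.
have [c c0 hc] := induced_norm_equiv nrmP.
have [b b1 hb] := norm1_word_mx_bound A.
pose C := 1 + c * (1 + norm1 (1%:M : 'M[R]_d)).
have C1 : 1 <= C by rewrite lerDl mulr_ge0 ?addr_ge0 ?norm1_ge0// ltW.
have C0 : 0 <= C := le_trans ler01 C1.
have b0 : 0 <= b := le_trans ler01 b1.
exists (C * b) => s; rewrite /word_rate; case: (posnP (size s)) => s0.
  (* For the empty word the exponent is the inverse of 0, that is 0, so the rate is 1. *)
  by rewrite s0 invr0 powRr0; rewrite -[leLHS]mulr1; apply: ler_pM.
have le : induced_norm nrm (word_mx A s) <= (C * b) ^+ size s.
  apply: le_trans (hc _).1 _; apply: le_trans (ler_wpM2l (ltW c0) (hb s)) _.
  rewrite exprMn mulrA; apply: ler_wpM2r; first exact: exprn_ge0.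
  apply: (@le_trans _ _ C); first by rewrite /C lerDr.
  by rewrite -[leLHS]expr1; apply: ler_weXn2l.
apply: le_trans (ge0_ler_powR _ _ _ le) _; rewrite ?nnegrE ?exprn_ge0 ?mulr_ge0//.
  exact: induced_norm_ge0.
by rewrite -powR_mulrn ?mulr_ge0// -powRrM divff ?pnatr_eq0 -?lt0n// powRr1// mulr_ge0.
Qed.

End WordRate.

(** * Expectations over the words read by a Markov chain *)

Section WordExpectation.
Context {R : realType} {N m : nat}.
Implicit Types (P : m.+1.-tuple 'I_N -> R) (u : m.-tuple 'I_N) (s : seq 'I_N)
  (F G : seq 'I_N -> R).

Definition next_state u (i : 'I_N) : m.-tuple 'I_N := [tuple of behead (rcons u i)].

(** The mean of [F] over the next [n] letters, given that the last [m] letters read form [u].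
    Recursion on the first letter suits inductions; [expect_tuple] recovers the sum over words. *)
Fixpoint expect P u n F : R :=
  if n is n'.+1 then
    \sum_(i < N) P [tuple of rcons u i] * expect P (next_state u i) n' (fun s => F (i :: s))
  else F [::].

Lemma eq_expect P u n F G : (forall s, size s = n -> F s = G s) ->
  expect P u n F = expect P u n G.
Proof.
elim: n u F G => [|n IH] u F G FG /=; first exact: FG.
apply: eq_bigr => i _; congr (_ * _); apply: IH => s sn; apply: FG => /=.
by rewrite sn.
Qed.

Lemma expectZ P u n a F : expect P u n (fun s => a * F s) = a * expect P u n F.
Proof.
elim: n u F => [//|n IH] u F /=; rewrite mulr_sumr; apply: eq_bigr => i _.
by rewrite (IH _ (fun s => F (i :: s))) mulrCA.
Qed.

Lemma expectD P u n F G :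
  expect P u n (fun s => F s + G s) = expect P u n F + expect P u n G.
Proof.
elim: n u F G => [//|n IH] u F G /=; rewrite -big_split/=; apply: eq_bigr => i _.
by rewrite (IH _ (fun s => F (i :: s))) mulrDr.
Qed.

(** The Markov property: what is read after [s] depends on the past only through the state
    reached. *)
Lemma expect_add P u n1 n2 F : expect P u (n1 + n2) F =
  expect P u n1 (fun s => expect P (foldl next_state u s) n2 (fun s' => F (s ++ s'))).
Proof.
elim: n1 u F => [|n1 IH] u F //=.
by apply: eq_bigr => i _; rewrite IH.
Qed.

Section Stochastic.
Variables (P : m.+1.-tuple 'I_N -> R) (Pst : stochastic_tensor P).

Lemma expect_le u n F G : (forall s, size s = n -> F s <= G s) ->
  expect P u n F <= expect P u n G.
Proof.
elim: n u F G => [|n IH] u F G FG /=; first exact: FG.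
apply: ler_sum => i _; apply: ler_wpM2l; first exact: Pst.1.
by apply: IH => s sn; apply: FG => /=; rewrite sn.
Qed.

Lemma expect_const u n a : expect P u n (fun=> a) = a.
Proof.
elim: n u => [//|n IH] u /=.
by under eq_bigr do rewrite IH; rewrite -mulr_suml Pst.2 mul1r.
Qed.

Lemma expect_ge0 u n F : (forall s, size s = n -> 0 <= F s) -> 0 <= expect P u n F.
Proof. by move=> F0; rewrite -(expect_const u n 0); exact: expect_le. Qed.

End Stochastic.

Lemma sum_tuple_cons n F :
  \sum_(t : n.+1.-tuple 'I_N) F t = \sum_i \sum_(t : n.-tuple 'I_N) F (i :: t).
Proof.
rewrite pair_big/= (reindex (fun p : 'I_N * n.-tuple 'I_N => [tuple of p.1 :: p.2]))//=.
exists (fun t : n.+1.-tuple 'I_N => (thead t, [tuple of behead t])) => [[i t] _|t _] /=.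
  by congr (_, _); exact: val_inj.
by apply: val_inj => /=; rewrite [in RHS](tuple_eta t).
Qed.

Lemma sum_tuple0 F : \sum_(t : 0.-tuple 'I_N) F t = F [::].
Proof.
rewrite (bigD1 [tuple])//= big1 ?addr0// => t.
by move=> /eqP[]; rewrite [t]tuple0; exact: val_inj.
Qed.

Lemma sum_tuple_cat n1 n2 F :
  \sum_(t : (n1 + n2).-tuple 'I_N) F t =
  \sum_(t1 : n1.-tuple 'I_N) \sum_(t2 : n2.-tuple 'I_N) F (t1 ++ t2).
Proof.
elim: n1 F => [|n1 IH] F.
  by rewrite (sum_tuple0 (fun s => \sum_(t2 : n2.-tuple 'I_N) F (s ++ t2))).
rewrite (sum_tuple_cons (n1 + n2)).
rewrite (sum_tuple_cons n1 (fun s => \sum_(t2 : n2.-tuple 'I_N) F (s ++ t2))).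
by apply: eq_bigr => i _; exact: (IH (fun s => F (i :: s))).
Qed.

Lemma tensor_at_tuple k (T : k.-tuple 'I_N -> R) (t : k.-tuple 'I_N) s :
  s = t :> seq _ -> tensor_at T s = T t.
Proof. by move=> ->; rewrite /tensor_at valK. Qed.

(** The window at position 0 is the transition out of [u], and the later windows are those of the
    next state. *)
Lemma expect_tuple P u k F :
  \sum_(s : k.-tuple 'I_N)
     (\prod_(j < k) tensor_at P (take m.+1 (drop j (u ++ s)))) * F s =
  expect P u k F.
Proof.
elim: k u F => [|k IH] u F /=.
  by under eq_bigr do rewrite big_ord0 mul1r; exact: sum_tuple0.
rewrite (sum_tuple_cons k
  (fun s => (\prod_(j < k.+1) tensor_at P (take m.+1 (drop j (u ++ s)))) * F s)).
apply: eq_bigr => i _; rewrite -(IH _ (fun s => F (i :: s))) mulr_sumr.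
apply: eq_bigr => s _; rewrite big_ord_recl/= drop0 -mulrA.
congr (_ * _); [|congr (_ * _)].
  apply: tensor_at_tuple; rewrite -cat_rcons take_size_cat//=.
  by rewrite size_rcons size_tuple.
apply: eq_bigr => j _; congr (tensor_at _ (take _ _)).
rewrite /bump/= add1n -cat_rcons; case: (tval u) => [|a v] /=; by rewrite ?drop0.
Qed.

End WordExpectation.

(** * Bounds for the Markov expectation and its upper limit *)

Section MarkovExpectation.
Context {R : realType} {d N m : nat} (nrm : 'cV[R]_d -> R).
Variables (nu : m.-tuple 'I_N -> R) (P : m.+1.-tuple 'I_N -> R).
Variable A : 'I_N -> 'M[R]_d.

Lemma markov_expectationE k : markov_expectation nrm nu P A (m + k) =
  \sum_(u : m.-tuple 'I_N) nu u * expect P u k (fun s => word_rate nrm A (u ++ s)).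
Proof.
rewrite /markov_expectation (sum_tuple_cat m k
  (fun t => tensor_at nu (take m t) *
    (\prod_(j < m + k - m) tensor_at P (take m.+1 (drop j t))) * word_rate nrm A t)).
apply: eq_bigr => u _; rewrite -expect_tuple mulr_sumr; apply: eq_bigr => s _.
rewrite take_size_cat ?size_tuple// (@tensor_at_tuple _ _ _ nu u)// -mulrA.
by rewrite addKn.
Qed.

(** For [n < m] the prefix [take m t] is too short, and the junk value of [tensor_at] is 0. This
    keeps the whole sequence bounded, as the lemmas on [limn_sup] require. *)
Lemma markov_expectation_lt n : (n < m)%N -> markov_expectation nrm nu P A n = 0.
Proof.
move=> nlt; rewrite /markov_expectation big1// => t _.
rewrite /tensor_at insubN ?mul0r// size_take size_tuple.
by rewrite (ltnNge m n) (ltnW nlt)/= neq_ltn nlt.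
Qed.

Hypotheses (Pst : stochastic_tensor P) (nuP : probability_tensor nu).
Hypothesis nrmP : is_vector_norm nrm.

Lemma markov_expectation_ge0 n : 0 <= markov_expectation nrm nu P A n.
Proof.
have [nlt|mn] := ltnP n m; first by rewrite markov_expectation_lt.
rewrite -(subnKC mn) markov_expectationE; apply: sumr_ge0 => u _.
by rewrite mulr_ge0 ?nuP.1//; apply: expect_ge0 => // s _; exact: word_rate_ge0.
Qed.

Lemma markov_expectation_le n a : (m <= n)%N ->
  (forall t : n.-tuple 'I_N, word_rate nrm A t <= a) ->
  markov_expectation nrm nu P A n <= a.
Proof.
move=> mn; rewrite -(subnKC mn) => ta; rewrite markov_expectationE.
apply: (@le_trans _ _ (\sum_u nu u * a)); last by rewrite -mulr_suml nuP.2 mul1r.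
apply: ler_sum => u _; apply: ler_wpM2l; first exact: nuP.1.
rewrite -[leRHS](expect_const Pst u (n - m) a); apply: expect_le => // s ss.
have sz : size (u ++ s) == (m + (n - m))%N by rewrite size_cat size_tuple ss.
exact: (ta (Tuple sz)).
Qed.

Lemma markov_expectation_bounded :
  exists b, forall n, `|markov_expectation nrm nu P A n| <= b.
Proof.
have [b hb] := word_rate_bound nrmP A.
have b0 : 0 <= b by apply: le_trans (hb [::]); exact: word_rate_ge0.
exists b => n; rewrite ger0_norm ?markov_expectation_ge0//.
have [nlt|mn] := ltnP n m; first by rewrite markov_expectation_lt.
by apply: markov_expectation_le mn _ => t; exact: hb.
Qed.

Lemma rho_p_pair_ge0 : 0 <= rho_p_pair nrm nu P A.
Proof.
have [b hb] := markov_expectation_bounded.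
by apply: limn_sup_ge hb _ => n; exists n => //; exact: markov_expectation_ge0.
Qed.

Lemma max_word_rate_bounded : exists b, forall n,
  `|\big[Num.max/0]_(t : n.-tuple 'I_N) word_rate nrm A t| <= b.
Proof.
have [b hb] := word_rate_bound nrmP A.
have b0 : 0 <= b by apply: le_trans (hb [::]); exact: word_rate_ge0.
exists b => n; rewrite ger0_norm ?bigmax_le//.
exact: bigmax_ge_id.
Qed.

(** An average of rates is at most their maximum. *)
Lemma rho_p_pair_le : rho_p_pair nrm nu P A <= rho_d nrm A.
Proof.
have [b hb] := markov_expectation_bounded; have [c hc] := max_word_rate_bounded.
apply: (le_limn_sup (b := Num.max b c) (n0 := m)).
- by move=> n; rewrite le_max hb.
- by move=> n; rewrite le_max hc orbT.
move=> n mn; apply: markov_expectation_le => // t.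
exact: (le_bigmax _ (fun t : n.-tuple 'I_N => word_rate nrm A t)).
Qed.

End MarkovExpectation.

(** * Complex eigenvalues of real products *)

Section Eigenvalues.
Context {R : realType}.

Lemma norm1_map_complex m n (M : 'M[R]_(m, n)) :
  norm1 (map_mx (real_complex R) M) = (norm1 M)%:C%C.
Proof.
rewrite /norm1 rmorph_sum; apply: eq_bigr => i _; rewrite rmorph_sum.
apply: eq_bigr => j _.
by rewrite mxE normc_def /= expr0n/= addr0 sqrtr_sqr.
Qed.

Context {d N : nat} (A : 'I_N -> 'M[R]_d).

(** The [q]-th power multiplies a row eigenvector by [z ^+ q], and the norm is submultiplicative. *)
Lemma eigenvalue_wpow s z q :
  eigenvalue (map_mx (real_complex R) (word_mx A s)) z ->
  ComplexField.Normc.normc z ^+ q <= norm1 (word_mx A (wpow s q)).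
Proof.
move=> /eigenvalueP[v vz v0].
have vq : v *m map_mx (real_complex R) (word_mx A (wpow s q)) = z ^+ q *: v.
  elim: q => [|q IH]; first by rewrite map_scalar_mx/= rmorph1 mulmx1 scale1r.
  rewrite /wpow/= word_mx_cat map_mxM mulmxA IH -scalemxAl vz scalerA.
  by rewrite -exprSr.
have := norm1M v (map_mx (real_complex R) (word_mx A (wpow s q))).
rewrite vq norm1Z norm1_map_complex mulrC normrX.
have vp : 0 < norm1 v.
  by rewrite lt_neqAle norm1_ge0 andbT; apply: contra v0 => /eqP/esym/norm1_eq0 ->.
rewrite ler_pM2l//.
have -> : `|z| = (ComplexField.Normc.normc z)%:C%C by case: z {vz vq} => a b.
by rewrite -rmorphXn lecR.
Qed.

(** If [v] is a row eigenvector of a product X Y for a nonzero [z], then v X is one of Y X; it is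
    nonzero because v X Y = z v. *)
Lemma eigenvalue_rot s z j : z != 0 ->
  eigenvalue (map_mx (real_complex R) (word_mx A s)) z ->
  eigenvalue (map_mx (real_complex R) (word_mx A (rot j s))) z.
Proof.
rewrite -{1}(cat_take_drop j s) /rot !word_mx_cat !map_mxM => z0.
move: (map_mx _ (word_mx A (drop j s))) (map_mx _ (word_mx A (take j s))) => X Y.
move=> /eigenvalueP[v vz v0]; apply/eigenvalueP; exists (v *m X).
  by rewrite mulmxA -(mulmxA v) vz scalemxAl.
apply: contra v0 => /eqP vX; have := vz; rewrite mulmxA vX mul0mx => /esym/eqP.
by rewrite scaler_eq0 (negPf z0).
Qed.

End Eigenvalues.

(** * The chain that repeats a word periodically *)

Section CyclicChain.
Context {R : realType} {N k' : nat}.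
Let k := k'.+1.
Variable t : k.-tuple 'I_N.

(* The chain of order [k] whose next letter repeats the one read [k] steps
   earlier; started from a rotation of [t], it reads [t] periodically. *)
Definition cyclic_tensor (w : k.+1.-tuple 'I_N) : R :=
  (last (thead w) w == thead w)%:R.

(** The sum runs over [j] and not over distinct rotations: a rotation that occurs several times,
    when [t] is itself a power, is counted with multiplicity. *)
Definition cyclic_measure (u : k.-tuple 'I_N) : R :=
  \sum_(j < k) k%:R^-1 * (u == [tuple of rot j t])%:R.

Lemma cyclic_tensor_rcons (u : k.-tuple 'I_N) i :
  cyclic_tensor [tuple of rcons u i] = (i == thead u)%:R.
Proof.
by case/tupleP: u => a u; rewrite /cyclic_tensor /= last_rcons !theadE.
Qed.

Lemma cyclic_tensor_stochastic : stochastic_tensor cyclic_tensor.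
Proof.
split=> [w|u]; first exact: ler0n.
rewrite (bigD1 (thead u))//= cyclic_tensor_rcons eqxx big1 ?addr0// => i iu.
by rewrite cyclic_tensor_rcons (negPf iu).
Qed.

Lemma cyclic_measure_probability : probability_tensor cyclic_measure.
Proof.
split=> [u|]; first by apply: sumr_ge0 => j _; rewrite mulr_ge0 ?ler0n.
rewrite exchange_big/= (eq_bigr (fun=> k%:R^-1)) => [|j _].
  by rewrite sumr_const card_ord -[LHS]mulr_natr mulVf// pnatr_eq0.
rewrite (bigD1 [tuple of rot j t])//= eqxx mulr1 big1 ?addr0// => u uj.
by rewrite (negPf uj) mulr0.
Qed.

(** The chain passes from one rotation to the next, so invariance is a shift of the index [j]; the
    ends agree since rotating by [k] gives [t] back. *)
Lemma cyclic_measure_invariant : invariant_tensor cyclic_measure cyclic_tensor.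
Proof.
move=> w; have lastE i : cyclic_tensor [tuple of i :: w] = (last i w == i)%:R.
  by rewrite /cyclic_tensor theadE.
pose a := last (thead t) w.
(* Only the last letter of [w] can precede [w]; the default of [last] is never returned because [w]
   is nonempty. *)
have lw i : last i w = a by rewrite /a; case: (tval w) (size_tuple w).
rewrite (bigD1 a)//= lastE lw eqxx mulr1 big1 ?addr0; last first.
  by move=> i /eqP ia; rewrite lastE lw; case: (a =P i) => [/esym//|_]; rewrite mulr0.
pose f j : R := k%:R^-1 * (tval w == rot j t)%:R.
have -> : cyclic_measure w = \sum_(j < k) f j.
  by apply: eq_bigr => j _; rewrite -val_eqE.
have -> : cyclic_measure [tuple of belast a w] = \sum_(j < k) f j.+1.
  apply: eq_bigr => j _; rewrite /f -val_eqE /=.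
  have -> : belast a w = rotr 1 w.
    rewrite /a; case: (tval w) (size_tuple w) => //= b v _.
    by rewrite (lastI b v) rotr1_rcons; case: (lastP v).
  rewrite -(inj_eq (@rot_inj 1 _)) rotrK -rotD ?add1n//.
  by rewrite size_tuple.
rewrite [LHS]big_ord_recr [RHS]big_ord_recl/= addrC; congr (_ + _).
by rewrite /f rot0 rot_oversize ?size_tuple.
Qed.

(** The chain is deterministic: [j] steps read the first [j] letters of the state and rotate it by
    [j]. For [j > k], [take] and [rot] no longer describe this. *)
Lemma expect_cyclic_rot (u : k.-tuple 'I_N) j n (F : seq 'I_N -> R) : (j <= k)%N ->
  expect cyclic_tensor u (j + n) F =
  expect cyclic_tensor [tuple of rot j u] n (fun s => F (take j u ++ s)).
Proof.
have step v l G : expect cyclic_tensor v l.+1 G =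
    expect cyclic_tensor [tuple of rot 1 v] l (fun s => G (thead v :: s)).
  rewrite /= (bigD1 (thead v))//= cyclic_tensor_rcons eqxx mul1r big1 ?addr0.
    congr expect; apply: val_inj => /=; case/tupleP: v => b v.
    by rewrite theadE/= rot1_cons.
  by move=> i iv; rewrite cyclic_tensor_rcons (negPf iv) mul0r.
elim: j n F => [|j IH] n F jk.
  rewrite add0n take0; congr expect; apply: val_inj => /=; by rewrite rot0.
rewrite addSnnS IH ?(ltnW jk)// step.
have ju : (j < size u)%N by rewrite size_tuple.
have -> : [tuple of rot 1 [tuple of rot j u]] = [tuple of rot j.+1 u].
  by apply: val_inj => /=; rewrite -(add1n j) rotD// size_tuple.
apply: eq_expect => s _; congr F; rewrite (take_nth (thead u))// cat_rcons.
congr (_ ++ _ :: _); rewrite /thead (tnth_nth (thead u))/= /rot.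
by rewrite (drop_nth (thead u)).
Qed.

Lemma expect_cyclic (u : k.-tuple 'I_N) q (F : seq 'I_N -> R) :
  expect cyclic_tensor u (q * k) F = F (wpow u q).
Proof.
elim: q F => [|q IH] F //; rewrite mulSn expect_cyclic_rot//.
have -> : [tuple of rot k u] = u.
  by apply: val_inj => /=; rewrite rot_oversize ?size_tuple.
rewrite (IH (fun s => F (take k u ++ s))) take_oversize ?size_tuple//.
Qed.

Context {d : nat} (nrm : 'cV[R]_d -> R) (A : 'I_N -> 'M[R]_d).
Hypothesis nrmP : is_vector_norm nrm.

(** At lengths that are multiples of [k], a state of positive mass is a rotation of [t] and the word
    read is a power of it, whose norm is at least the power of [normc z] up to a constant. The root
    of that constant tends to 1. *)
Lemma normc_le_rho_p_pair z : z != 0 ->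
  eigenvalue (map_mx (real_complex R) (word_mx A t)) z ->
  ComplexField.Normc.normc z `^ k%:R^-1 <=
  rho_p_pair nrm cyclic_measure cyclic_tensor A.
Proof.
move=> z0 ez; set r := _ `^ _.
have nz0 : 0 <= ComplexField.Normc.normc z by case: z {z0 ez r} => a b; exact: sqrtr_ge0.
have [b hb] := markov_expectation_bounded A cyclic_tensor_stochastic
  cyclic_measure_probability nrmP.
have r0 : 0 <= r by exact: powR_ge0.
apply/ler_addgt0Pr => e e0; pose e' := e / (r + 1).
have e'0 : 0 < e' by rewrite divr_gt0// ltr_wpDl.
suff : r * (1 - e') <= rho_p_pair nrm cyclic_measure cyclic_tensor A.
  have : r * e' <= e.
    by rewrite /e' mulrCA -[leRHS]mulr1 ler_pM2l// ler_pdivrMr ?ltr_wpDl// mul1r lerDl.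
  lra.
have [c c0 hc] := induced_norm_equiv nrmP.
have ci0 : 0 < c^-1 by rewrite invr_gt0.
have [n1 hn1] := powR_inv_cvg1_lower ci0 e'0.
apply: limn_sup_ge hb _ => n0; pose q := maxn n0 n1.
exists (k + q * k)%N.
  apply: leq_trans (leq_maxl n0 n1) _; apply: leq_trans (leq_addl _ _).
  by rewrite -/q leq_pmulr.
rewrite markov_expectationE.
have -> : r * (1 - e') = \sum_u cyclic_measure u * (r * (1 - e')).
  by rewrite -mulr_suml cyclic_measure_probability.2 mul1r.
apply: ler_sum => u _; rewrite expect_cyclic.
have [->|] := eqVneq (cyclic_measure u) 0; first by rewrite !mul0r.
move=> nu0; apply: ler_wpM2l; first exact: cyclic_measure_probability.1.
have [j uj] : exists j : 'I_k, u = [tuple of rot j t].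
  apply: contrapT => /forallNP nuj; move/eqP: nu0; apply; apply: big1 => j _.
  by have [/(nuj j)//|_] := eqVneq u [tuple of rot j t]; rewrite mulr0.
rewrite -[tval u ++ wpow u q]/(wpow u q.+1) /word_rate size_wpow size_tuple.
have [qk1 hq] : (0 < q.+1 * k)%N /\ 1 - e' <= c^-1 `^ (q.+1 * k)%:R^-1.
  apply: hn1; apply: leq_trans (leq_maxr n0 n1) _.
  by rewrite -/q; apply: leq_trans (leqnSn q) _; rewrite leq_pmulr.
apply: (@le_trans _ _ ((c^-1 * ComplexField.Normc.normc z ^+ q.+1) `^ (q.+1 * k)%:R^-1)).
  have rE : (ComplexField.Normc.normc z ^+ q.+1) `^ (q.+1 * k)%:R^-1 = r.
    by rewrite -powR_mulrn// -powRrM natrM invfM mulrA divff ?pnatr_eq0// mul1r.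
  rewrite powRM ?exprn_ge0 ?(ltW ci0)// rE mulrC; exact: ler_wpM2r.
apply: ge0_ler_powR; rewrite ?invr_ge0 ?nnegrE//.
- by rewrite mulr_ge0 ?exprn_ge0// ltW.
- exact: induced_norm_ge0.
rewrite -(ler_pM2l c0) mulrA divff ?gt_eqF// mul1r; apply: le_trans (hc _).2.
by apply: eigenvalue_wpow; rewrite uj; exact: eigenvalue_rot.
Qed.

Lemma spectral_radius_le_rho_p_pair :
  spectral_radius (word_mx A t) `^ k%:R^-1 <=
  rho_p_pair nrm cyclic_measure cyclic_tensor A.
Proof.
set L := rho_p_pair _ _ _ _.
have L0 : 0 <= L by apply: rho_p_pair_ge0 => //;
  [exact: cyclic_tensor_stochastic|exact: cyclic_measure_probability].
have k0 : k%:R != 0 :> R by rewrite pnatr_eq0.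
pose S := [set ComplexField.Normc.normc z | z in
  [set z | eigenvalue (map_mx (real_complex R) (word_mx A t)) z]].
have nz0 (z : R[i]) : 0 <= ComplexField.Normc.normc z by case: z => a b; exact: sqrtr_ge0.
have SL : ubound S (L ^+ k).
  move=> _ [z /= ez <-]; have [->|z0] := eqVneq z 0.
    by rewrite ComplexField.Normc.normc0 exprn_ge0.
  rewrite -[leLHS]powRr1// -(mulVf k0) powRrM powR_mulrn ?powR_ge0//.
  by apply: lerXn2r; rewrite ?nnegrE ?powR_ge0//; exact: normc_le_rho_p_pair.
have /andP[s0] : 0 <= spectral_radius (word_mx A t) <= L ^+ k.
  rewrite /spectral_radius -/S.
  (* In dimension 0 there is no eigenvalue, and the supremum of the empty set is 0. *)
  have [->|/set0P[x Sx]] := eqVneq S set0; first by rewrite sup0 lexx exprn_ge0.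
  apply/andP; split; last by apply: ge_sup => //; exists x.
  apply: (@le_trans _ _ x); first by case: Sx => z _ <-.
  by apply: ub_le_sup => //; exists (L ^+ k).
move=> sL; apply: le_trans (ge0_ler_powR _ _ _ sL) _; rewrite ?nnegrE ?exprn_ge0//.
by rewrite -powR_mulrn// -powRrM divff// powRr1.
Qed.

End CyclicChain.

(** * Powers of a matrix with eigenvalues in the open unit disc *)

Section PowersTendToZero.
Context {R : realType}.
Local Notation normc := ComplexField.Normc.normc.

Lemma geometric_small (a e : R) : 0 <= a < 1 -> 0 < e ->
  exists n0, forall n, (n0 <= n)%N -> a ^+ n <= e.
Proof.
move=> /andP[a0 a1] e0.
have /cvgrPdist_le/(_ e e0)[n0 _ h] : (fun n => a ^+ n) @ \oo --> (0 : R).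
  by apply: cvg_expr; rewrite ger0_norm.
exists n0 => n /h /=; rewrite sub0r normrN ger0_norm// exprn_ge0//.
Qed.

Lemma affine_recursion_small (u v : nat -> R) (a : R) : 0 <= a < 1 ->
  (forall k, 0 <= u k) -> (forall k, u k.+1 <= a * u k + v k) ->
  (forall e, 0 < e -> exists k0, forall k, (k0 <= k)%N -> v k <= e) ->
  forall e, 0 < e -> exists k0, forall k, (k0 <= k)%N -> u k <= e.
Proof.
move=> /andP[a0 a1] u0 uv v0 e e0.
(* With this bound on [v], the affine recursion has fixed point [e / 2], and the influence of the
   starting value decays like [a ^+ j]. *)
have [k0 hk0] : exists k0, forall k, (k0 <= k)%N -> v k <= e / 2 * (1 - a).
  by apply: v0; rewrite mulr_gt0// ?divr_gt0// subr_gt0.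
have uj j : u (k0 + j)%N <= a ^+ j * u k0 + e / 2.
  elim: j => [|j IH]; first by rewrite addn0 expr0 mul1r lerDl divr_ge0// ltW.
  rewrite addnS; apply: le_trans (uv _) _; rewrite exprS.
  have := hk0 _ (leq_addr j k0); have := ler_wpM2l a0 IH; lra.
have u1 : 0 < u k0 + 1 by rewrite ltr_wpDl.
have [j0 hj0] : exists n0, forall n, (n0 <= n)%N -> a ^+ n <= e / 2 / (u k0 + 1).
  by apply: geometric_small; rewrite ?a0//= !divr_gt0.
exists (k0 + j0)%N => k kj; have k0k := leq_trans (leq_addr _ _) kj.
rewrite -(subnKC k0k); apply: le_trans (uj _) _.
have := hj0 (k - k0)%N; rewrite leq_subRL// => /(_ kj).
rewrite ler_pdivlMr//; have : 0 <= a ^+ (k - k0) by exact: exprn_ge0.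
nra.
Qed.

(** On complex matrices [norm1] is complex-valued; this version takes real values, for comparison
    with real bounds. *)
Let nmc m n (X : 'M[R[i]]_(m, n)) := \sum_i \sum_j normc (X i j).

Let nmcD m n (X Y : 'M[R[i]]_(m, n)) : nmc (X + Y) <= nmc X + nmc Y.
Proof.
rewrite /nmc -big_split; apply: ler_sum => i _; rewrite -big_split.
by apply: ler_sum => j _; rewrite mxE; exact: le_normcD.
Qed.

Let nmcZ m n a (X : 'M[R[i]]_(m, n)) : nmc (a *: X) = normc a * nmc X.
Proof.
rewrite /nmc mulr_sumr; apply: eq_bigr => i _; rewrite mulr_sumr.
by apply: eq_bigr => j _; rewrite mxE; exact: ComplexField.Normc.normcM.
Qed.

Let nmc_ge0 m n (X : 'M[R[i]]_(m, n)) : 0 <= nmc X.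
Proof.
by apply: sumr_ge0 => i _; apply: sumr_ge0 => j _; case: (X i j) => a b; exact: sqrtr_ge0.
Qed.

Let nmc_map m n (X : 'M[R]_(m, n)) : nmc (map_mx (real_complex R) X) = norm1 X.
Proof.
apply: eq_bigr => i _; apply: eq_bigr => j _.
by rewrite mxE /= expr0n/= addr0 sqrtr_sqr.
Qed.

(* By induction on the factors: with [Y = (T - r) X] one has
   [T^(k+1) X = r T^k X + T^k Y]. *)
Let annihilated_small d (T : 'M[R[i]]_d.+1) (rs : seq R[i]) (X : 'M[R[i]]_d.+1) :
  (forall r, r \in rs -> normc r < 1) -> (\prod_(r <- rs) (T - r%:M)) * X = 0 ->
  forall e, 0 < e -> exists k0, forall k, (k0 <= k)%N -> nmc (T ^+ k * X) <= e.
Proof.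
elim/last_ind: rs X => [|rs r IH] X rs1.
  rewrite big_nil mul1r => -> e e0; exists 0%N => k _; rewrite mulr0.
  by rewrite /nmc big1 ?ltW// => i _; rewrite big1// => j _; rewrite mxE ComplexField.Normc.normc0.
rewrite big_rcons/= -mulrA => /IH Ysmall.
apply: (@affine_recursion_small _ (fun k => nmc (T ^+ k * ((T - r%:M) * X))) (normc r)).
- rewrite rs1 ?mem_rcons ?mem_head// andbT; case: (r) => a b; exact: sqrtr_ge0.
- by move=> k; exact: nmc_ge0.
- move=> k; rewrite -nmcZ.
  have -> : T ^+ k.+1 * X = r *: (T ^+ k * X) + T ^+ k * ((T - r%:M) * X).
    have rX : r%:M * X = r *: X := mul_scalar_mx r X.
    by rewrite mulrBl mulrBr mulrA -exprSr rX -scalerAr addrC subrK.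
  exact: nmcD.
- by apply: Ysmall => s srs; apply: rs1; rewrite mem_rcons inE srs orbT.
Qed.

(** By the Cayley-Hamilton theorem the product of the [T - r%:M] over the eigenvalues is zero, so
    [annihilated_small] applies to the identity matrix. *)
Lemma power_small d (M : 'M[R]_d.+1) :
  (forall z, eigenvalue (map_mx (real_complex R) M) z -> normc z < 1) ->
  forall e, 0 < e -> exists k, norm1 (M ^+ k) <= e.
Proof.
move=> Mz e e0; pose T := map_mx (real_complex R) M.
have [rs hrs] := closed_field_poly_normal (char_poly T).
have rs1 r : r \in rs -> normc r < 1.
  move=> rrs; apply: Mz; rewrite eigenvalue_root_char hrs.
  by rewrite rootZ ?root_prod_XsubC// (monicP (char_poly_monic T)) oner_neq0.
have T0 : \prod_(r <- rs) (T - r%:M) * 1 = 0.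
  rewrite mulr1 -(Cayley_Hamilton T) hrs (monicP (char_poly_monic T)) scale1r.
  rewrite rmorph_prod/=; apply: eq_bigr => r _.
  by rewrite rmorphB/= horner_mx_X horner_mx_C.
have [k0 /(_ k0 (leqnn _))] := annihilated_small rs1 T0 e0.
by rewrite mulr1 /T -rmorphXn/= nmc_map => h; exists k0.
Qed.

Lemma wpow_small d N (A : 'I_N -> 'M[R]_d) s :
  (forall z, eigenvalue (map_mx (real_complex R) (word_mx A s)) z -> normc z < 1) ->
  forall e, 0 < e -> exists k, norm1 (word_mx A (wpow s k)) <= e.
Proof.
case: d A => [|d] A Az e e0.
  by exists 0%N; rewrite [word_mx _ _]flatmx0 norm1_0 ltW.
have [k hk] := power_small Az e0; exists k.
suff -> : word_mx A (wpow s k) = word_mx A s ^+ k by [].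
elim: k {hk} => [|k IH]; first by [].
by rewrite /wpow/= word_mx_cat IH exprSr.
Qed.

Lemma spectral_radius_ge d (M : 'M[R]_d) z :
  eigenvalue (map_mx (real_complex R) M) z -> normc z <= spectral_radius M.
Proof.
move=> ez; apply: ub_le_sup; last by exists z.
exists (norm1 M) => _ [y /= ey <-].
(* [M] is treated as a family with one letter, to bound its eigenvalues by [norm1 M]. *)
have := @eigenvalue_wpow R d 1 (fun=> M) [:: ord0] y 1.
by rewrite /wpow/= word_mx1 expr1; exact.
Qed.

End PowersTendToZero.

(** * Uniform decay of mean norms for bounded products *)

Section UniformContraction.
Context {R : realType} {N : nat}.

(** The form in which the normalization of [rho_d] to 1 is used; it passes to the blocks of a
    triangular decomposition. *)
Definition subexponential d (A : 'I_N -> 'M[R]_d) := forall e, 0 < e ->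
  exists C, forall s, norm1 (word_mx A s) <= C * (1 + e) ^+ size s.

Definition cycles_vanish d (A : 'I_N -> 'M[R]_d) := forall s, s != [::] ->
  forall e, 0 < e -> exists k, norm1 (word_mx A (wpow s k)) <= e.

(** The threshold [n0] comes before [P] and [u]: this uniformity is what keeps the supremum [rho_p]
    away from [rho_d]. *)
Definition mean_vanish m d (A : 'I_N -> 'M[R]_d) := forall e, 0 < e ->
  exists n0, forall n, (n0 <= n)%N -> forall (P : m.+1.-tuple 'I_N -> R) u,
  stochastic_tensor P -> expect P u n (fun s => norm1 (word_mx A s)) <= e.

Lemma expect_norm1_add m d (A : 'I_N -> 'M[R]_d) (P : m.+1.-tuple 'I_N -> R) u n1 n2 a :
  stochastic_tensor P ->
  (forall u', expect P u' n2 (fun s => norm1 (word_mx A s)) <= a) ->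
  expect P u (n1 + n2) (fun s => norm1 (word_mx A s)) <=
  a * expect P u n1 (fun s => norm1 (word_mx A s)).
Proof.
move=> Pst Ea; rewrite expect_add -expectZ; apply: expect_le => // s _.
apply: (@le_trans _ _ (expect P (foldl next_state u s) n2
    (fun s' => norm1 (word_mx A s) * norm1 (word_mx A s')))).
  by apply: expect_le => // s' _; rewrite word_mx_cat mulrC norm1M.
by rewrite (expectZ _ _ _ _ (fun s' => norm1 (word_mx A s'))) mulrC ler_wpM2r ?norm1_ge0.
Qed.

Lemma expect_norm1_iter m d (A : 'I_N -> 'M[R]_d) (P : m.+1.-tuple 'I_N -> R) n a :
  0 <= a -> stochastic_tensor P ->
  (forall u, expect P u n (fun s => norm1 (word_mx A s)) <= a) ->
  forall q r u, expect P u (r + q * n) (fun s => norm1 (word_mx A s)) <=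
    a ^+ q * expect P u r (fun s => norm1 (word_mx A s)).
Proof.
move=> a0 Pst Ea; elim=> [|q IH] r u; first by rewrite addn0 mul1r.
rewrite mulSn [(n + _)%N]addnC addnA exprS -mulrA.
by apply: le_trans (expect_norm1_add _ _ Pst Ea) _; rewrite ler_wpM2l.
Qed.

(** A single length with mean at most [a < 1] from every state suffices: full blocks contribute
    powers of [a], and the remainder, shorter than [n], a bounded factor. *)
Lemma mean_vanishI m d (A : 'I_N -> 'M[R]_d) n a : (0 < n)%N -> 0 <= a < 1 ->
  (forall (P : m.+1.-tuple 'I_N -> R) u, stochastic_tensor P ->
    expect P u n (fun s => norm1 (word_mx A s)) <= a) ->
  mean_vanish m A.
Proof.
move=> n0 a01 Ea e e0; have a0 := proj1 (andP a01).
have [b b1 hb] := norm1_word_mx_bound A; have b0 := le_trans ler01 b1.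
pose C := (1 + norm1 (1%:M : 'M[R]_d)) * b ^+ n.
have C0 : 0 <= C by rewrite mulr_ge0 ?exprn_ge0// addr_ge0 ?norm1_ge0.
have [q0 hq0] : exists q0, forall q, (q0 <= q)%N -> a ^+ q <= e / (C + 1).
  by apply: geometric_small; rewrite ?divr_gt0// ltr_wpDl.
exists (q0 * n)%N => n' qn P u Pst; rewrite (divn_eq n' n) addnC.
apply: le_trans (expect_norm1_iter a0 Pst (fun u => Ea P u Pst) _ _ _) _.
have le : expect P u (n' %% n) (fun s => norm1 (word_mx A s)) <= C.
  rewrite -(expect_const Pst u (n' %% n) C); apply: expect_le => // s ss.
  apply: le_trans (hb s) _; apply: ler_wpM2l; first by rewrite addr_ge0 ?norm1_ge0.
  by apply: ler_weXn2l => //; rewrite ss ltnW// ltn_pmod.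
have := hq0 (n' %/ n)%N; rewrite leq_divRL// => /(_ qn) hq.
apply: le_trans (ler_wpM2l (exprn_ge0 _ a0) le) _.
apply: le_trans (ler_wpM2r C0 hq) _.
by rewrite -mulrA -[leRHS]mulr1 ler_pM2l// ler_pdivrMl ?ltr_wpDl// mulr1 lerDl.
Qed.

Section Greedy.
Variables (m : nat) (P : m.+1.-tuple 'I_N -> R).
Hypothesis Pst : stochastic_tensor P.

Lemma likely_letter (u : m.-tuple 'I_N) : exists i, N%:R^-1 <= P [tuple of rcons u i].
Proof.
apply: contrapT => /forallNP Plt.
have lt i : P [tuple of rcons u i] < N%:R^-1 by rewrite ltNge; apply/negP.
have N0 : (0 < N)%N.
  rewrite lt0n; apply/eqP => N0; have := Pst.2 u; rewrite big1 => [/eqP|i _].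
    by rewrite eq_sym oner_eq0.
  by have := ltn_ord i; rewrite [X in (_ < X)%N]N0.
have : \sum_(i < N) P [tuple of rcons u i] < \sum_(i < N) N%:R^-1.
  apply: ltr_sum => [|i _]; last exact: lt.
  by apply/hasP; exists (Ordinal N0); rewrite ?mem_index_enum.
rewrite Pst.2 sumr_const card_ord -[_ *+ N]mulr_natr mulVf ?ltxx//.
by rewrite pnatr_eq0 -lt0n.
Qed.

Variable best : m.-tuple 'I_N -> 'I_N.
Hypothesis bestP : forall u : m.-tuple 'I_N, N%:R^-1 <= P [tuple of rcons u (best u)].

Fixpoint greedy n (u : m.-tuple 'I_N) : seq 'I_N := if n is n'.+1 then
  best u :: greedy n' (next_state u (best u)) else [::].

Let step (u : m.-tuple 'I_N) := next_state u (best u).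

Lemma greedy_add n1 n2 u : greedy (n1 + n2) u = greedy n1 u ++ greedy n2 (iter n1 step u).
Proof. by elim: n1 u => //= n1 IH u; rewrite IH -iterSr. Qed.

Lemma size_greedy n u : size (greedy n u) = n.
Proof. by elim: n u => //= n IH u; rewrite IH. Qed.

Lemma greedy_loop p q u : iter p step u = u -> greedy (q * p) u = wpow (greedy p u) q.
Proof. by move=> pu; elim: q => //= q IH; rewrite mulSn greedy_add pu IH. Qed.

(** The word [greedy n u] has probability at least [N%:R^-1 ^+ n], and on it [F] gains [b - c] over
    its general bound. *)
Lemma expect_greedy_le n u (F : seq 'I_N -> R) b c : c <= b ->
  (forall s, size s = n -> F s <= b) -> F (greedy n u) <= c ->
  expect P u n F <= b - (b - c) * N%:R^-1 ^+ n.
Proof.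
move=> cb; elim: n u F => [|n IH] u F Fb Fc /=; first by rewrite expr0 mulr1; lra.
pose i0 := best u; pose x := (b - c) * N%:R^-1 ^+ n.
apply: (@le_trans _ _ (\sum_(i < N) P [tuple of rcons u i] * (b - (i == i0)%:R * x))).
  apply: ler_sum => i _; apply: ler_wpM2l; first exact: Pst.1.
  have [->|_] := eqVneq i i0; rewrite ?mul1r ?mul0r ?subr0.
    by apply: IH => // s ss; apply: Fb; rewrite /= ss.
  rewrite -[leRHS](expect_const Pst (next_state u i) n b); apply: expect_le => // s ss.
  by apply: Fb; rewrite /= ss.
under eq_bigr do rewrite mulrBr.
rewrite sumrB -mulr_suml Pst.2 mul1r lerD2l lerN2.
rewrite (bigD1 i0)//= eqxx mul1r big1 ?addr0; last first.
  by move=> i ii0; rewrite (negPf ii0) mul0r mulr0.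
rewrite exprS mulrCA; apply: ler_wpM2r; last exact: bestP.
by rewrite mulr_ge0 ?subr_ge0// exprn_ge0// invr_ge0 ler0n.
Qed.

(** Pigeonhole: among one more iterates than there are states, two coincide. *)
Lemma greedy_cycle u : exists i p,
  [/\ (0 < p)%N, (i + p <= #|{: m.-tuple 'I_N}|)%N &
   iter p step (iter i step u) = iter i step u].
Proof.
pose Q := #|{: m.-tuple 'I_N}|.
have /injectivePn[i [j ij fij]] : ~~ injectiveb (fun j : 'I_Q.+1 => iter j step u).
  by apply/injectiveP => /leq_card; rewrite card_ord ltnn.
wlog lt : i j ij fij / (i < j)%N.
  move=> H; have [lt|lt|/val_inj eq] := ltngtP i j; [exact: (H i j)| |].
    by apply: (H j i) => //; rewrite eq_sym.
  by rewrite eq eqxx in ij.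
exists i, (j - i)%N; rewrite subn_gt0 lt subnKC ?(ltnW lt)//; split => //.
  by rewrite -ltnS.
by rewrite -iterD subnK ?(ltnW lt).
Qed.

End Greedy.

Section Bounded.
Variables (m d : nat) (A : 'I_N -> 'M[R]_d) (C : R).
Hypothesis AC : forall s, norm1 (word_mx A s) <= C.

Let C0 : 0 <= C. Proof. exact: le_trans (norm1_ge0 _) (AC [::]). Qed.

(* An equivalent norm for which left multiplication by a product of the [A i]
   is nonexpansive. *)
Let g (M : 'M[R]_d) := sup [set norm1 (word_mx A w *m M) | w in [set: seq 'I_N]].

Let g_ub (M : 'M[R]_d) :
  ubound [set norm1 (word_mx A w *m M) | w in [set: seq 'I_N]] (C * norm1 M).
Proof.
move=> _ [w _ <-]; apply: le_trans (norm1M _ _) _.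
by apply: ler_wpM2r; [exact: norm1_ge0|exact: AC].
Qed.

Let g_le (M : 'M[R]_d) : g M <= C * norm1 M.
Proof. by apply: ge_sup; [exists (norm1 (word_mx A [::] *m M)), [::]|exact: g_ub]. Qed.

Let g_ge (M : 'M[R]_d) w : norm1 (word_mx A w *m M) <= g M.
Proof. by apply: ub_le_sup; [exists (C * norm1 M); exact: g_ub|exists w]. Qed.

Let norm1_le_g (M : 'M[R]_d) : norm1 M <= g M.
Proof. by rewrite -{1}[M]mul1mx; exact: (g_ge M [::]). Qed.

Let g_word (M : 'M[R]_d) w : g (word_mx A w *m M) <= g M.
Proof.
apply: ge_sup; first by exists (norm1 (word_mx A [::] *m (word_mx A w *m M))), [::].
by move=> _ [w' _ <-]; rewrite mulmxA -word_mx_cat; exact: g_ge.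
Qed.

Let g_ge0 (M : 'M[R]_d) : 0 <= g M := le_trans (norm1_ge0 M) (norm1_le_g M).

Let g_contract (M : 'M[R]_d) s : C * norm1 (word_mx A s) <= 2^-1 ->
  g (word_mx A s *m M) <= 2^-1 * g M.
Proof.
move=> Cs; apply: le_trans (g_le _) _.
apply: le_trans (ler_wpM2l C0 (norm1M _ _)) _; rewrite mulrA.
by apply: ler_pM => //; rewrite ?mulr_ge0 ?norm1_ge0.
Qed.

(* Following a most likely letter at each step, the chain runs with probability
   at least [N%:R^-1 ^+ l] into a loop of its finite state space; if [l] is
   large, the word read contains a power of that cycle whose product is small. *)
Lemma bounded_mean_vanish : (0 < N)%N -> cycles_vanish A -> mean_vanish m A.
Proof.
move=> N0 Acyc; pose Q := #|{: m.-tuple 'I_N}|.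
have e0 : 0 < 2^-1 / (C + 1) by rewrite divr_gt0// ltr_wpDl.
have [K hK] : {K : seq 'I_N -> nat & forall s, s != [::] ->
    C * norm1 (word_mx A (wpow s (K s))) <= 2^-1}.
  apply: (@choice _ _ (fun s k => s != [::] -> C * norm1 (word_mx A (wpow s k)) <= 2^-1)) => s.
  have [->|s0] := eqVneq s [::]; first by exists 0%N.
  have [k hk] := Acyc s s0 _ e0; exists k => _.
  apply: le_trans (ler_wpM2l C0 hk) _.
  by rewrite mulrCA -[leRHS]mulr1 ler_pM2l// ler_pdivrMr ?ltr_wpDl// mul1r lerDl.
(* One length [l] for all starting states: finitely many words [t] have length at most [Q], and the
   sum of the lengths of their powers [wpow t (K t)] dominates each of them, with [Q.+1] left for
   the way into the loop. *)
have [l l0 hl] : exists2 l, (0 < l)%N & forall i t, (i + size t <= Q)%N ->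
    (i + K t * size t <= l)%N.
  exists (Q.+1 + \sum_(p < Q.+1) \sum_(t : p.-tuple 'I_N) K t * p)%N => // i t iQ.
  have tQ : (size t < Q.+1)%N by rewrite ltnS; apply: leq_trans (leq_addl i _) iQ.
  have {}iQ : (i <= Q.+1)%N by rewrite leqW// (leq_trans (leq_addr _ _) iQ).
  apply: leq_add => //; rewrite (bigD1 (Ordinal tQ))//= (bigD1 (in_tuple t))//= -addnA.
  exact: leq_addr.
(* In every [l] letters, an event of probability at least [N%:R^-1 ^+ l] halves [g], which otherwise
   does not increase. *)
pose th : R := 1 - 2^-1 * N%:R^-1 ^+ l.
have th01 : 0 <= th < 1.
  have N1 : 0 < (N%:R^-1 : R) by rewrite invr_gt0 ltr0n.
  have h1 : 0 < (N%:R^-1 ^+ l : R) by rewrite exprn_gt0.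
  have h2 : (N%:R^-1 ^+ l : R) <= 1.
    by rewrite exprn_ile1 ?(ltW N1)// invf_le1 ?ltr0n// ler1n.
  by rewrite /th; move: (_ ^+ l) h1 h2 => x h1 h2; lra.
have step (P : m.+1.-tuple 'I_N -> R) u (M : 'M[R]_d) : stochastic_tensor P ->
    expect P u l (fun s => g (word_mx A s *m M)) <= th * g M.
  move=> Pst; have [best bestP] := choice (likely_letter Pst).
  have -> : th * g M = g M - (g M - 2^-1 * g M) * N%:R^-1 ^+ l.
    by rewrite /th; move: (_ ^+ l) (g M) => x y; field.
  apply: (expect_greedy_le Pst bestP); first by have := g_ge0 M; lra.
    by move=> s _; exact: g_word.
  have [i [p [p0 ip loop]]] := greedy_cycle best u.
  set v := iter i _ u in loop; pose t := greedy best p v.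
  have tp : size t = p by rewrite size_greedy.
  have il : (i + K t * p <= l)%N by rewrite -tp hl// tp.
  (* The greedy word is a way into the loop, then [K t] turns of it, then a rest; the contraction
     comes from the middle factor. *)
  have -> : greedy best l u = greedy best i u ++ wpow t (K t) ++
      greedy best (l - (i + K t * p)) (iter (i + K t * p) (fun u => next_state u (best u)) u).
    by rewrite -{1}(subnKC il) !greedy_add (greedy_loop _ loop) -catA.
  have t0 : t != [::] by rewrite -size_eq0 tp -lt0n.
  rewrite !word_mx_cat -!mulmxA; apply: le_trans (g_word _ _) _.
  apply: le_trans (g_contract _ (hK t t0)) _.
  by apply: ler_wpM2l; [lra|exact: g_word].
have iter_step q (P : m.+1.-tuple 'I_N -> R) u : stochastic_tensor P ->
    expect P u (q * l) (fun s => g (word_mx A s)) <= th ^+ q * g 1%:M.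
  move=> Pst; elim: q => [|q IH]; first by rewrite mul1r.
  rewrite mulSn addnC expect_add exprS -mulrA.
  apply: le_trans (ler_wpM2l (proj1 (andP th01)) IH); rewrite -expectZ.
  apply: expect_le => // s _; apply: le_trans (step _ _ _ Pst).
  by apply: expect_le => // s' _; rewrite word_mx_cat.
have [q0 hq0] : exists q0, forall q, (q0 <= q)%N -> th ^+ q <= 2^-1 / (g 1%:M + 1).
  by apply: geometric_small; rewrite ?divr_gt0// ltr_wpDl.
apply: (@mean_vanishI m d A (q0.+1 * l) 2^-1); first by rewrite muln_gt0.
  lra.
move=> P u Pst; apply: (@le_trans _ _ (expect P u (q0.+1 * l) (fun s => g (word_mx A s)))).
  by apply: expect_le.
apply: le_trans (iter_step _ _ _ Pst) _.
apply: le_trans (ler_wpM2r (g_ge0 _) (hq0 _ (leqnSn _))) _.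
by rewrite -mulrA -[leRHS]mulr1 ler_pM2l// ler_pdivrMl ?ltr_wpDl// mulr1 lerDl.
Qed.

End Bounded.
End UniformContraction.

(** * Block triangular families *)

Section Reduction.
Context {R : realType} {N : nat}.

Section Block.
Variables (d r s : nat) (A : 'I_N -> 'M[R]_d).
Variables (U : 'M[R]_(r, d)) (W : 'M[R]_(s, d)).
Variables (X : 'M[R]_(d, r)) (Y : 'M[R]_(d, s)).
Hypotheses (XYUW : X *m U + Y *m W = 1%:M) (UX : U *m X = 1%:M) (WY : W *m Y = 1%:M).
Hypothesis UAY : forall i, U *m A i *m Y = 0.

(** The matrix with row blocks [U], [W] has the inverse with column blocks [X], [Y]. By [UAY] the
    row space of [U] is invariant: in the new basis products are block lower triangular, with
    off-diagonal block [D]. *)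
Definition sub_block i := U *m A i *m X.
Definition quotient_block i := W *m A i *m Y.
Let D t := W *m word_mx A t *m X.

Let UY : U *m Y = 0.
Proof.
have UYW : U *m Y *m W = 0.
  by apply: (addrI U); rewrite addr0 -{1}(mul1mx U) -UX -!mulmxA -mulmxDr XYUW mulmx1.
by rewrite -[Y]mulmx1 -WY !mulmxA UYW mul0mx.
Qed.

Lemma word_sub_block t : U *m word_mx A t = word_mx sub_block t *m U.
Proof.
have UA i : U *m A i = sub_block i *m U.
  by rewrite -[LHS]mulmx1 -XYUW mulmxDr !mulmxA UAY mul0mx addr0.
elim/last_ind: t => [|t i IH]; first by rewrite mulmx1 mul1mx.
by rewrite !word_mx_rcons mulmxA UA -mulmxA IH mulmxA.
Qed.

Lemma sub_blockE t : word_mx sub_block t = U *m word_mx A t *m X.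
Proof. by rewrite word_sub_block -mulmxA UX mulmx1. Qed.

Lemma word_quotient_block t : word_mx A t *m Y = Y *m word_mx quotient_block t.
Proof.
have AY i : A i *m Y = Y *m quotient_block i.
  rewrite -[LHS]mul1mx -XYUW mulmxDl -!mulmxA [U *m _]mulmxA UAY mulmx0 add0r.
  by rewrite /quotient_block !mulmxA.
elim/last_ind: t => [|t i IH]; first by rewrite mulmx1 mul1mx.
by rewrite !word_mx_rcons -mulmxA IH mulmxA AY -mulmxA.
Qed.

Lemma quotient_blockE t : word_mx quotient_block t = W *m word_mx A t *m Y.
Proof. by rewrite -mulmxA word_quotient_block mulmxA WY mul1mx. Qed.

(** The rule for the off-diagonal block when two block triangular matrices are multiplied. *)
Let D_cat t t' : D (t ++ t') =
  D t' *m word_mx sub_block t + word_mx quotient_block t' *m D t.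
Proof.
rewrite /D word_mx_cat sub_blockE quotient_blockE.
by rewrite -[word_mx A t' in LHS]mulmx1 -XYUW !(mulmxDl, mulmxDr) !mulmxA.
Qed.

Let norm1_word_block t : norm1 (word_mx A t) <=
  (norm1 X * norm1 U + norm1 Y * norm1 W + norm1 Y * norm1 U) *
  (norm1 (word_mx sub_block t) + norm1 (word_mx quotient_block t) + norm1 (D t)).
Proof.
have -> : word_mx A t =
  X *m word_mx sub_block t *m U + Y *m word_mx quotient_block t *m W + Y *m D t *m U.
  rewrite -(mulmxA X) -word_sub_block quotient_blockE /D -addrA.
  rewrite -{1}[word_mx A t]mul1mx -{1}XYUW mulmxDl -mulmxA; congr (_ + _).
  by rewrite -[LHS]mulmx1 -XYUW mulmxDr !mulmxA addrC.
have le (a b : nat) (Z : 'M[R]_(d, a)) (M : 'M[R]_(a, b)) (Z' : 'M[R]_(b, d)) :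
    norm1 (Z *m M *m Z') <= norm1 Z * norm1 Z' * norm1 M.
  apply: le_trans (norm1M _ _) _; rewrite mulrAC.
  by apply: ler_wpM2r; [exact: norm1_ge0|exact: norm1M].
have g a b (M : 'M[R]_(a, b)) := norm1_ge0 M.
apply: le_trans (norm1D _ _) _; apply: le_trans (lerD (norm1D _ _) (le _ _ _ _ _)) _.
apply: le_trans (lerD (lerD (le _ _ _ _ _) (le _ _ _ _ _)) (lexx _)) _.
rewrite !mulrDl !mulrDr.
have h1 := mulr_ge0 (mulr_ge0 (g _ _ X) (g _ _ U)) (g _ _ (word_mx quotient_block t)).
have h2 := mulr_ge0 (mulr_ge0 (g _ _ X) (g _ _ U)) (g _ _ (D t)).
have h3 := mulr_ge0 (mulr_ge0 (g _ _ Y) (g _ _ W)) (g _ _ (word_mx sub_block t)).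
have h4 := mulr_ge0 (mulr_ge0 (g _ _ Y) (g _ _ W)) (g _ _ (D t)).
have h5 := mulr_ge0 (mulr_ge0 (g _ _ Y) (g _ _ U)) (g _ _ (word_mx sub_block t)).
have h6 := mulr_ge0 (mulr_ge0 (g _ _ Y) (g _ _ U)) (g _ _ (word_mx quotient_block t)).
lra.
Qed.

(* The off-diagonal block [D] satisfies [D_cat], so its expectation over [q]
   blocks of length [n] is again geometrically small. *)
Lemma block_mean_vanish m :
  mean_vanish m sub_block -> mean_vanish m quotient_block -> mean_vanish m A.
Proof.
move=> Bm Cm.
have q0 : 0 < 4^-1 :> R by lra.
have [n1 hn1] := Bm _ q0; have [n2 hn2] := Cm _ q0; pose n := (maxn n1 n2).+1.
have n1n : (n1 <= n)%N by rewrite leqW// leq_maxl.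
have n2n : (n2 <= n)%N by rewrite leqW// leq_maxr.
have [b b1 hb] := norm1_word_mx_bound A.
pose K := norm1 W * ((1 + norm1 (1%:M : 'M[R]_d)) * b ^+ n) * norm1 X.
have K0 : 0 <= K.
  by rewrite !mulr_ge0 ?norm1_ge0 ?addr_ge0 ?norm1_ge0 ?exprn_ge0// (le_trans ler01).
have DK t : size t = n -> norm1 (D t) <= K.
  move=> tn; apply: le_trans (norm1M _ _) _; apply: ler_wpM2r; first exact: norm1_ge0.
  apply: le_trans (norm1M _ _) _; apply: ler_wpM2l; first exact: norm1_ge0.
  by rewrite -tn.
have EB q (P : m.+1.-tuple 'I_N -> R) u : stochastic_tensor P ->
    expect P u (q.+1 * n) (fun t => norm1 (word_mx sub_block t)) <= 4^-1 ^+ q.+1.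
  move=> Pst; rewrite mulSn exprSr.
  have En v := hn1 n n1n P v Pst.
  apply: le_trans (expect_norm1_iter (ltW q0) Pst En _ _ _) _.
  by apply: ler_wpM2l; [rewrite exprn_ge0// ltW|exact: En].
have EC q (P : m.+1.-tuple 'I_N -> R) u : stochastic_tensor P ->
    expect P u (q.+1 * n) (fun t => norm1 (word_mx quotient_block t)) <= 4^-1 ^+ q.+1.
  move=> Pst; rewrite mulSn exprSr.
  have En v := hn2 n n2n P v Pst.
  apply: le_trans (expect_norm1_iter (ltW q0) Pst En _ _ _) _.
  by apply: ler_wpM2l; [rewrite exprn_ge0// ltW|exact: En].
(* One more block of letters gives at most [K * 4^-1 ^+ q.+1] plus a quarter of the previous mean.
   Both terms are at most a quarter of [K * 2^-1 ^+ q], so the bound reproduces itself. *)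
have ED q (P : m.+1.-tuple 'I_N -> R) u : stochastic_tensor P ->
    expect P u (q.+1 * n) (fun t => norm1 (D t)) <= K * 2^-1 ^+ q.
  move=> Pst; elim: q => [|q IH].
    by rewrite mul1n expr0 mulr1 -(expect_const Pst u n K); exact: expect_le.
  rewrite mulSn addnC expect_add.
  apply: (@le_trans _ _ (expect P u (q.+1 * n) (fun t =>
      K * norm1 (word_mx sub_block t) + 4^-1 * norm1 (D t)))).
    apply: expect_le => // t _; set v := foldl _ _ _.
    apply: (@le_trans _ _ (expect P v n (fun t' => K * norm1 (word_mx sub_block t) +
        norm1 (D t) * norm1 (word_mx quotient_block t')))).
      apply: expect_le => // t' t'n; rewrite D_cat; apply: le_trans (norm1D _ _) _.
      apply: lerD; first by apply: le_trans (norm1M _ _) _; rewrite ler_wpM2r ?norm1_ge0 ?DK.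
      by rewrite mulrC; exact: norm1M.
    rewrite (expectD _ _ _ (fun=> _)) expect_const// lerD2l.
    rewrite (expectZ _ _ _ _ (fun t' => norm1 (word_mx quotient_block t'))) mulrC.
    by apply: ler_wpM2r; [exact: norm1_ge0|exact: hn2].
  rewrite expectD !(expectZ _ _ _ _ (fun t => norm1 _)).
  have := ler_wpM2l K0 (EB q P u Pst).
  have : (4^-1 : R) ^+ q.+1 <= 4^-1 * 2^-1 ^+ q.
    rewrite exprS; apply: ler_wpM2l; first exact: ltW.
    by apply: lerXn2r; rewrite ?nnegrE; lra.
  move=> /(ler_wpM2l K0); rewrite [2^-1 ^+ q.+1]exprS.
  move: IH; set e1 := expect _ _ _ _; set e2 := expect _ _ _ _.
  move: (2^-1 ^+ q) (4^-1 ^+ q.+1) => x y; nra.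
pose c := norm1 X * norm1 U + norm1 Y * norm1 W + norm1 Y * norm1 U.
have c0 : 0 <= c by rewrite !addr_ge0// mulr_ge0 ?norm1_ge0.
have [q hq] : exists q, (2^-1 : R) ^+ q <= 2^-1 / (c * (2 + K) + 1).
  have [||q0' /(_ q0' (leqnn _))] := @geometric_small R 2^-1 (2^-1 / (c * (2 + K) + 1)).
  - lra.
  - by rewrite divr_gt0// ltr_wpDl// mulr_ge0// addr_ge0.
  by exists q0'.
apply: (@mean_vanishI _ _ m d A (q.+1 * n) 2^-1); first by rewrite muln_gt0.
  lra.
move=> P u Pst.
apply: le_trans (expect_le Pst u (fun t _ => norm1_word_block t)) _.
rewrite -/c expectZ !expectD.
have := EB q P u Pst; have := EC q P u Pst; have := ED q P u Pst.
have h4 : (4^-1 : R) ^+ q.+1 <= 2^-1 ^+ q.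
  have h : (4^-1 : R) ^+ q <= 2^-1 ^+ q by apply: lerXn2r; rewrite ?nnegrE; lra.
  have h0 : 0 <= (4^-1 : R) ^+ q by rewrite exprn_ge0//; lra.
  by rewrite exprS; lra.
move=> hD hC hB.
apply: (@le_trans _ _ (c * ((2 + K) * 2^-1 ^+ q))).
  by apply: ler_wpM2l => //; rewrite mulrDl; lra.
rewrite mulrA; apply: le_trans (ler_wpM2l _ hq) _.
  by rewrite mulr_ge0// addr_ge0.
have k0 : 0 <= c * (2 + K) by rewrite mulr_ge0// addr_ge0.
by rewrite mulrCA -[leRHS]mulr1 ler_pM2l// ler_pdivrMr ?ltr_wpDl// mul1r lerDl.
Qed.

End Block.
End Reduction.

(** * Row vectors with bounded orbit *)

Section BoundedOrbits.
Context {R : realType} {N d : nat} (A : 'I_N -> 'M[R]_d).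

Definition bounded_orbit (x : 'rV[R]_d) := exists C, forall s, norm1 (x *m word_mx A s) <= C.

Lemma bounded_orbit0 : bounded_orbit 0.
Proof. by exists 0 => s; rewrite mul0mx norm1_0. Qed.

Lemma bounded_orbitD x y : bounded_orbit x -> bounded_orbit y -> bounded_orbit (x + y).
Proof.
move=> [C hC] [C' hC']; exists (C + C') => s; rewrite mulmxDl.
by apply: le_trans (norm1D _ _) (lerD _ _).
Qed.

Lemma bounded_orbitZ a x : bounded_orbit x -> bounded_orbit (a *: x).
Proof.
move=> [C hC]; exists (`|a| * C) => s.
by rewrite -scalemxAl norm1Z ler_wpM2l.
Qed.

Lemma bounded_orbit_mul x i : bounded_orbit x -> bounded_orbit (x *m A i).
Proof. by move=> [C hC]; exists C => s; rewrite -mulmxA -word_mx_rcons. Qed.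

(** Among the subspaces whose vectors have bounded orbits, one of maximal rank contains every such
    vector, since adjoining another would raise the rank. *)
Lemma bounded_orbit_subspace :
  exists U : 'M[R]_d, forall x, (x <= U)%MS <-> bounded_orbit x.
Proof.
pose p r := `[< exists U : 'M[R]_d, \rank U = r /\
  forall x : 'rV_d, (x <= U)%MS -> bounded_orbit x >].
have p0 : exists r, p r.
  exists 0%N; apply/asboolP; exists 0; rewrite mxrank0; split=> // x.
  by rewrite submx0 => /eqP ->; exact: bounded_orbit0.
have pd r : p r -> (r <= d)%N by move=> /asboolP[U [<- _]]; exact: rank_leq_row.
case: (ex_maxnP p0 pd) => r /asboolP[U [Ur Ub]] rmax; exists U => x.
split=> [|xb]; first exact: Ub.
apply: contrapT => /negP xU.
suff : (\rank (U + x)%MS <= r)%N.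
  rewrite leqNgt -Ur; move/negP; apply; apply: rank_ltmx.
  by rewrite ltmxE addsmxSl/= addsmx_sub submx_refl.
apply: rmax; apply/asboolP; exists (U + x)%MS; split=> // y /sub_addsmxP[[a b] /= ->].
apply: bounded_orbitD; first by apply: Ub; rewrite submxMl.
by rewrite [b]mx11_scalar mul_scalar_mx; exact: bounded_orbitZ.
Qed.

(* If no orbit but that of [0] were bounded, then by compactness finitely many
   words would suffice to double the norm of any row vector, so that words of
   length at most [q L] would produce growth [2 ^ q]. *)
Lemma exists_bounded_orbit : (0 < d)%N -> subexponential A ->
  exists2 x, x != 0 & bounded_orbit x.
Proof.
move=> d0 Asub; apply: contrapT => nx.
have unb (x : 'rV[R]_d) : norm1 x = 1 -> exists w, 0 < norm1 (x *m word_mx A w) - 2.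
  move=> x1; apply: contrapT => /forallNP h; apply: nx; exists x.
    by apply/eqP => x0; move: x1; rewrite x0 norm1_0 => /eqP; rewrite eq_sym oner_eq0.
  by exists 2 => w; rewrite -subr_le0 leNgt; apply/negP.
have lip w (x y : 'rV[R]_d) : norm1 (x *m word_mx A w) - 2 - (norm1 (y *m word_mx A w) - 2) <=
    norm1 (word_mx A w) * norm1 (x - y).
  rewrite opprB addrA subrK; apply: le_trans (norm1B _ _) _.
  by rewrite -mulmxBl mulrC; exact: norm1M.
have [S hS] := norm1_sphere_cover lip unb.
pose L := \max_(w <- S) size w.
pose x0 : 'rV[R]_d := delta_mx 0 (Ordinal d0).
have x01 : norm1 x0 = 1.
  rewrite /norm1 big_ord1 (bigD1 (Ordinal d0))//= !mxE !eqxx normr1 big1 ?addr0//.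
  by move=> j /negPf jd; rewrite mxE jd andbF normr0.
have grow q : exists2 s, (size s <= q * L)%N & 2 ^+ q <= norm1 (x0 *m word_mx A s).
  elim: q => [|q [s sq hs]]; first by exists [::]; rewrite // mulmx1 x01.
  pose y := x0 *m word_mx A s.
  have yp : 0 < norm1 y by apply: lt_le_trans hs; rewrite exprn_gt0.
  have [w wS] := hS ((norm1 y)^-1 *: y) (norm1_normalize (lt0r_neq0 yp)).
  rewrite -scalemxAl norm1Z gtr0_norm ?invr_gt0// subr_gt0 mulrC ltr_pdivlMr// => hw.
  (* Row vectors meet the last letter first, so the new word [w] goes in front of [s]. *)
  exists (w ++ s); first by rewrite size_cat mulSn leq_add// leq_bigmax_seq.
  rewrite word_mx_cat mulmxA -/y exprS; apply: le_trans (ltW hw).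
  by apply: ler_wpM2l.
(* The root is chosen so that [b ^+ L.+1 = 2]: growth [2 ^+ q] on words of length at most [q * L],
   against a bound proportional to [b ^+ (q * L)], would leave [b ^+ q] bounded although [b > 1]. *)
pose b : R := 2 `^ L.+1%:R^-1.
have b0 : 0 <= b by exact: powR_ge0.
have bL : b ^+ L.+1 = 2 by rewrite -powR_mulrn// -powRrM mulVf ?pnatr_eq0// powRr1.
have b1 : 1 < b.
  rewrite ltNge; apply/negP => b1; have := exprn_ile1 L.+1 b0 b1.
  by rewrite bL; lra.
have be : 0 < b - 1 by rewrite subr_gt0.
have [C hC] := Asub _ be; rewrite addrC subrK in hC.
have bC q : b ^+ q <= `|C|.
  have [s sq hs] := grow q.
  have : 2 ^+ q <= `|C| * b ^+ (q * L).
    apply: le_trans hs _; apply: le_trans (norm1M _ _) _; rewrite x01 mul1r.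
    apply: le_trans (hC s) _; apply: (@le_trans _ _ (`|C| * b ^+ size s)).
      by apply: ler_wpM2r; [rewrite exprn_ge0|exact: ler_norm].
    by apply: ler_wpM2l => //; apply: ler_weXn2l => //; exact: ltW.
  rewrite -bL -exprM mulSn mulnC exprD ler_pM2r// exprn_gt0//.
  exact: lt_trans b1.
have C1 : 1 <= `|C| by have := bC 0%N; rewrite expr0.
have [||q /(_ q (leqnn _))] := @geometric_small R b^-1 (2^-1 / `|C|).
- by rewrite invr_ge0 b0 invf_lt1//; exact: lt_trans b1.
- by rewrite divr_gt0//; exact: lt_le_trans C1.
rewrite exprVn -invfM lef_pV2 ?posrE ?exprn_gt0 ?mulr_gt0
  ?(lt_trans ltr01 b1) ?(lt_le_trans ltr01 C1)//.
by have := bC q; lra.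
Qed.

End BoundedOrbits.

(** * Induction on the dimension *)

Section MeanVanish.
Context {R : realType} {N : nat}.

Lemma subexponential_norm1 d d' (A : 'I_N -> 'M[R]_d) (B : 'I_N -> 'M[R]_d')
  (U : 'M[R]_(d', d)) (X : 'M[R]_(d, d')) :
  (forall s, word_mx B s = U *m word_mx A s *m X) -> subexponential A -> subexponential B.
Proof.
move=> BA Asub e e0; have [C hC] := Asub e e0.
exists (norm1 U * C * norm1 X) => s; rewrite BA; apply: le_trans (norm1M _ _) _.
rewrite mulrAC; apply: ler_wpM2r; first exact: norm1_ge0.
apply: le_trans (norm1M _ _) _; rewrite -mulrA; apply: ler_wpM2l => //; exact: norm1_ge0.
Qed.

Lemma cycles_vanish_norm1 d d' (A : 'I_N -> 'M[R]_d) (B : 'I_N -> 'M[R]_d')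
  (U : 'M[R]_(d', d)) (X : 'M[R]_(d, d')) :
  (forall s, word_mx B s = U *m word_mx A s *m X) -> cycles_vanish A -> cycles_vanish B.
Proof.
move=> BA Acyc s s0 e e0; have UX : 0 <= norm1 U * norm1 X by rewrite mulr_ge0 ?norm1_ge0.
have e' : 0 < e / (norm1 U * norm1 X + 1) by rewrite divr_gt0// ltr_wpDl.
have [k hk] := Acyc s s0 _ e'; exists k; rewrite BA.
apply: le_trans (norm1M _ _) _; apply: le_trans (ler_wpM2r (norm1_ge0 _) (norm1M _ _)) _.
rewrite mulrAC; apply: le_trans (ler_wpM2l UX hk) _.
by rewrite mulrCA -[leRHS]mulr1 ler_pM2l// ler_pdivrMr ?ltr_wpDl// mul1r lerDl.
Qed.

Theorem mean_vanish_of_cycles m d (A : 'I_N -> 'M[R]_d) : (0 < N)%N ->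
  subexponential A -> cycles_vanish A -> mean_vanish m A.
Proof.
move=> N0; have [k] := ubnP d; elim: k d A => // k IH d A; rewrite ltnS => dk Asub Acyc.
have [d0|d0] := posnP d.
  move=> e e0; exists 0%N => n _ P u Pst; rewrite -(expect_const Pst u n e).
  apply: expect_le => // s _; rewrite (_ : word_mx A s = 0) ?norm1_0 ?ltW//.
  by apply/matrixP => i; have := ltn_ord i; rewrite {2}d0.
have [V hV] := bounded_orbit_subspace A.
have [x x0 /hV xV] := exists_bounded_orbit d0 Asub.
have V0 : (0 < \rank V)%N.
  rewrite lt0n mxrank_eq0; apply: contra x0 => /eqP V0.
  by move: xV; rewrite V0 submx0.
have [Vfull|Vnfull] := boolP (row_full V).
  (* If [V] is everything, the basis vectors have bounded orbits, hence all products are bounded by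
     the sum of the bounds for their rows. *)
  have /choice[C hC] : forall i, exists C, forall s, norm1 (row i (word_mx A s)) <= C.
    move=> i; have /hV[C hC] : ((delta_mx 0 i : 'rV[R]_d) <= V)%MS by exact: submx_full.
    by exists C => s; rewrite rowE.
  apply: (@bounded_mean_vanish _ _ m d A (\sum_i C i)) => // s.
  by rewrite norm1_row; apply: ler_sum => i _.
have Vd : (\rank V < d)%N.
  by rewrite ltn_neqAle rank_leq_col andbT.
have [U eU fU] : exists2 U : 'M[R]_(\rank V, d), (U :=: V)%MS & row_free U.
  by exists (row_base V); [exact: eq_row_base|exact: row_base_free].
have [W eW fW] : exists2 W : 'M[R]_(\rank V^C, d), (W :=: V^C)%MS & row_free W.
  by exists (row_base V^C%MS); [exact: eq_row_base|exact: row_base_free].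
(* Writing the identity in the joined bases produces the blocks [X], [Y] of the inverse base change.
   As [V] and its complement meet only in 0, comparing coefficients then yields the other
   relations. *)
have /sub_addsmxP[[X Y] /= XYUW] : (1%:M <= U + W)%MS.
  apply: (@submx_trans _ _ _ _ _ _ (V + V^C)%MS); first exact/submx_full/addsmx_compl_full.
  by apply: addsmxS; rewrite ?eU ?eW.
have disj a (Z : 'M[R]_(a, _)) (Z' : 'M[R]_(a, _)) :
    Z *m U = Z' *m W -> Z = 0 /\ Z' = 0.
  move=> E; have ZU0 : Z *m U = 0.
    apply/eqP; rewrite -submx0 -(capmx_compl V) sub_capmx.
    apply/andP; split; first by rewrite -eU submxMl.
    by rewrite E -eW submxMl.
  split; [apply: (row_free_inj fU)|apply: (row_free_inj fW)].
    by rewrite mul0mx.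
  by rewrite mul0mx -[RHS]ZU0 E.
have [UX UY] : U *m X = 1%:M /\ U *m Y = 0.
  have [|/eqP h1 h2] := disj _ (1%:M - U *m X) (U *m Y).
    apply/eqP; rewrite mulmxBl mul1mx -!mulmxA subr_eq -mulmxDr.
    by rewrite [Y *m W + _]addrC -XYUW mulmx1.
  by split=> //; apply/esym/eqP; rewrite -subr_eq0.
have [WX WY] : W *m X = 0 /\ W *m Y = 1%:M.
  have [|h1 /eqP h2] := disj _ (W *m X) (1%:M - W *m Y).
    apply/eqP; rewrite mulmxBl mul1mx -!mulmxA eq_sym subr_eq -mulmxDr.
    by rewrite -XYUW mulmx1.
  by split=> //; apply/esym/eqP; rewrite -subr_eq0.
(* A vector of bounded orbit stays one under [A i], so [V] is invariant, and [Y] vanishes on [V]. *)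
have UAY i : U *m A i *m Y = 0.
  apply/row_matrixP => j; rewrite row0 !row_mul.
  have /hV/bounded_orbit_mul-/(_ i)/hV : (row j U <= V)%MS.
    by rewrite -eU row_sub.
  rewrite -eU => /submxP[Z ->].
  by rewrite -mulmxA UY mulmx0.
have XYUW1 : X *m U + Y *m W = 1%:M by [].
have BE := sub_blockE XYUW1 UX UAY; have CE := quotient_blockE XYUW1 WY UAY.
(* Both blocks are smaller than [d], as [V] is neither zero nor everything. *)
apply: (block_mean_vanish XYUW1 UX WY UAY).
  apply: IH; [exact: leq_trans Vd dk|exact: subexponential_norm1 BE _|].
  exact: cycles_vanish_norm1 BE _.
apply: IH; [|exact: subexponential_norm1 CE _|exact: cycles_vanish_norm1 CE _].
rewrite mxrank_compl; apply: leq_trans dk.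
by rewrite ltn_subLR ?rank_leq_col//; rewrite -[X in (X < _)%N]add0n ltn_add2r.
Qed.

End MeanVanish.

(** * From mean norms to the two radii *)

Section Assembly.
Context {R : realType} {d N : nat} (nrm : 'cV[R]_d -> R).
Hypothesis nrmP : is_vector_norm nrm.
Implicit Types A : 'I_N -> 'M[R]_d.

Lemma mean_vanish_geometric m A : mean_vanish m A ->
  exists th K, [/\ 0 < th < 1, 0 < K & forall j (P : m.+1.-tuple 'I_N -> R) u,
    stochastic_tensor P -> expect P u j (fun s => norm1 (word_mx A s)) <= K * th ^+ j].
Proof.
move=> Am; have h0 : 0 < 2^-1 :> R by lra.
have [n0 /(_ n0.+1 (leqnSn _)) hn] := Am _ h0; pose n := n0.+1.
pose th : R := 2^-1 `^ n%:R^-1.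
have th0 : 0 < th by exact: powR_gt0.
have thn : th ^+ n = 2^-1.
  by rewrite -powR_mulrn ?ltW// -powRrM mulVf ?pnatr_eq0// powRr1// ltW.
have th1 : th < 1.
  by rewrite ltNge; apply/negP => /(exprn_ege1 n); rewrite thn; lra.
have [b b1 hb] := norm1_word_mx_bound A; have b0 := lt_le_trans ltr01 b1.
pose C := (1 + norm1 (1%:M : 'M[R]_d)) * b ^+ n.
have C0 : 0 < C by rewrite mulr_gt0 ?exprn_gt0// ltr_pwDl ?norm1_ge0.
(* For [j] equal to [q * n] plus a remainder, [2^-1 ^+ q] is [th ^+ (q * n)]; dividing by [th ^+ n]
   compensates for the remainder. *)
exists th, (C / th ^+ n); rewrite th0 th1; split=> //.
  by rewrite divr_gt0// exprn_gt0.
move=> j P u Pst; rewrite {1}(divn_eq j n) addnC.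
apply: le_trans (expect_norm1_iter (ltW h0) Pst (fun u => hn P u Pst) _ _ _) _.
have le : expect P u (j %% n) (fun s => norm1 (word_mx A s)) <= C.
  rewrite -[leRHS](expect_const Pst u (j %% n)); apply: expect_le => // s ss.
  apply: le_trans (hb s) _; apply: ler_wpM2l; first by rewrite addr_ge0 ?norm1_ge0.
  by apply: ler_weXn2l => //; rewrite ss ltnW// ltn_pmod.
apply: le_trans (ler_wpM2l _ le) _; first by rewrite exprn_ge0// ltW.
rewrite -thn -exprM [leLHS]mulrC -[leRHS]mulrA; apply: ler_wpM2l; first exact: ltW.
rewrite [leRHS]mulrC ler_pdivlMr ?exprn_gt0// -exprD; apply: ler_wiXn2l; try exact: ltW.
by rewrite addnC -mulnS mulnC ltnW// ltn_ceil.
Qed.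

(* By concavity of [x `^ n^-1] it suffices to bound the expectation of the norm. *)
Lemma rho_p_pair_le_growth m (nu : m.-tuple 'I_N -> R) (P : m.+1.-tuple 'I_N -> R) A K r :
  stochastic_tensor P -> probability_tensor nu -> 0 < K -> 0 < r ->
  (forall u j, expect P u j (fun s => norm1 (word_mx A s)) <= K * r ^+ j) ->
  rho_p_pair nrm nu P A <= r.
Proof.
move=> Pst nuP K0 r0 hK.
have [c c0 hc] := induced_norm_equiv nrmP.
have [C C0 hC] : exists2 C, 0 < C & forall u : m.-tuple 'I_N, norm1 (word_mx A u) <= C.
  have [b b1 hb] := norm1_word_mx_bound A; have b0 := lt_le_trans ltr01 b1.
  exists ((1 + norm1 (1%:M : 'M[R]_d)) * b ^+ m).
    by rewrite mulr_gt0 ?exprn_gt0// ltr_pwDl ?norm1_ge0.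
  by move=> u; rewrite -[in b ^+ m](size_tuple u); exact: hb.
(* [c] compares the norms, [C] bounds the product of the first [m] letters, and [r ^+ m] accounts
   for the chain reading only [n - m] letters. *)
pose K' := c * C * K / r ^+ m.
have K'0 : 0 < K' by rewrite divr_gt0 ?exprn_gt0// !mulr_gt0.
have [B hB] := markov_expectation_bounded A Pst nuP nrmP.
apply/ler_addgt0Pr => e e0.
have er : 0 < e / r by rewrite divr_gt0.
have [n0 hn0] := powR_inv_cvg1 K'0 er.
apply: (limn_sup_le (n0 := maxn n0 m) hB) => n; rewrite geq_max => /andP[n0n mn].
have [npos Kn] := hn0 n n0n.
pose a := K' * r ^+ n; have a0 : 0 < a by rewrite mulr_gt0// exprn_gt0.
have aE : a `^ n%:R^-1 <= r + e.
  rewrite powRM ?exprn_ge0// ?(ltW r0) ?(ltW K'0)//.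
  rewrite -(powR_mulrn n (ltW r0)) -powRrM divff ?pnatr_eq0 -?lt0n// powRr1 ?(ltW r0)//.
  apply: le_trans (ler_wpM2r (ltW r0) Kn) _.
  by rewrite mulrDl mul1r divfK// gt_eqF.
apply: le_trans aE; rewrite -(subnKC mn) markov_expectationE (subnKC mn).
set j := (n - m)%N.
have -> : a `^ n%:R^-1 = \sum_u nu u * a `^ n%:R^-1 by rewrite -mulr_suml nuP.2 mul1r.
apply: ler_sum => u _; apply: ler_wpM2l; first exact: nuP.1.
have ind : expect P u j (fun s => induced_norm nrm (word_mx A (u ++ s))) <= a.
  apply: (@le_trans _ _ (expect P u j (fun s => c * C * norm1 (word_mx A s)))).
    apply: expect_le => // s _; apply: le_trans (hc _).1 _.
    rewrite -mulrA; apply: ler_wpM2l; first exact: ltW.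
    rewrite word_mx_cat; apply: le_trans (norm1M _ _) _; rewrite mulrC.
    by apply: ler_wpM2r; [exact: norm1_ge0|exact: hC].
  rewrite expectZ; apply: le_trans (ler_wpM2l _ (hK u j)) _.
    by rewrite mulr_ge0// ltW.
  rewrite /a /K' -(subnK mn) -/j exprD [r ^+ j * _]mulrC !mulrA divfK//.
  by rewrite gt_eqF// exprn_gt0.
pose x := a `^ n%:R^-1; have x0 : 0 <= x by exact: powR_ge0.
have nR : 0 < (n%:R : R)^-1 by rewrite invr_gt0 ltr0n.
(* The tangent of the [n]-th root at [a]: being affine in the norm, it lets the bound on the mean
   norm be inserted. *)
apply: (@le_trans _ _ (expect P u j (fun s => x * (1 - n%:R^-1) +
    x / (n%:R * a) * induced_norm nrm (word_mx A (u ++ s))))).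
  apply: expect_le => // s sj; rewrite /word_rate size_cat size_tuple sj subnKC//.
  set y := induced_norm _ _; have y0 : 0 <= y by exact: induced_norm_ge0.
  have -> : y `^ n%:R^-1 = x * (y / a) `^ n%:R^-1.
    rewrite -powRM; [|exact: ltW|by rewrite divr_ge0// ltW].
    by rewrite mulrCA divff ?mulr1// gt_eqF.
  apply: le_trans (ler_wpM2l x0 (powR_inv_le _ npos)) _; first by rewrite divr_ge0// ltW.
  rewrite le_eqVlt; apply/orP; left; apply/eqP.
  by field; rewrite !gt_eqF// ltr0n.
rewrite (expectD _ _ _ (fun=> _)) expect_const// expectZ -/x.
apply: (@le_trans _ _ (x * (1 - n%:R^-1) + x / (n%:R * a) * a)).
  by rewrite lerD2l; apply: ler_wpM2l => //; rewrite divr_ge0// mulr_ge0 ?ler0n// ltW.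
rewrite le_eqVlt; apply/orP; left; apply/eqP.
by field; rewrite !gt_eqF// ltr0n.
Qed.

(** The upper limit of the means along the cyclic chain of [t] lies between the two sides. *)
Lemma spectral_radius_le_rho_d A k (t : k.+1.-tuple 'I_N) :
  spectral_radius (word_mx A t) `^ k.+1%:R^-1 <= rho_d nrm A.
Proof.
apply: le_trans (spectral_radius_le_rho_p_pair t A nrmP) _.
apply: rho_p_pair_le => //; [exact: cyclic_tensor_stochastic|exact: cyclic_measure_probability].
Qed.

(** From some length on, the rates are below [r * (1 + e)]; the shorter words are absorbed in the
    constant. *)
Lemma rho_d_subexponential A : 0 < rho_d nrm A ->
  subexponential (fun i => (rho_d nrm A)^-1 *: A i).
Proof.
set r := rho_d nrm A => r0 e e0.
have [c c0 hc] := induced_norm_equiv nrmP.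
have [M hM] := max_word_rate_bounded A nrmP.
have [n0 hn0] : exists n0, forall n, (n0 <= n)%N ->
    \big[Num.max/0]_(t : n.-tuple 'I_N) word_rate nrm A t < r * (1 + e).
  by apply: limn_sup_lt hM _; rewrite -/r -/(rho_d nrm A) ltr_pMr// ltrDl.
have [b b1 hb] := norm1_word_mx_bound (fun i => r^-1 *: A i).
have b0 := lt_le_trans ltr01 b1; pose n := n0.+1.
pose C := (1 + norm1 (1%:M : 'M[R]_d)) * b ^+ n.
have C0 : 0 < C by rewrite mulr_gt0 ?exprn_gt0// ltr_pwDl ?norm1_ge0.
exists (c + C) => s.
have e1 : 1 <= (1 + e) ^+ size s by apply: exprn_ege1; rewrite lerDl ltW.
have [sn|sn] := leqP (size s) n.
  apply: (@le_trans _ _ (C * 1)); last first.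
    by apply: ler_pM => //; rewrite ?ltW// ltrDr.
  rewrite mulr1; apply: le_trans (hb s) _.
  apply: ler_wpM2l; first by rewrite addr_ge0 ?norm1_ge0.
  exact: ler_weXn2l.
apply: (@le_trans _ _ (c * (1 + e) ^+ size s)); last first.
  by apply: ler_wpM2r; [exact: le_trans ler01 e1|rewrite lerDl ltW].
have s0 : (0 < size s)%N by apply: leq_trans sn.
rewrite word_mxZ norm1Z ger0_norm ?exprn_ge0 ?invr_ge0 ?(ltW r0)// exprVn.
rewrite ler_pdivrMl ?exprn_gt0// mulrCA -exprMn.
apply: le_trans (hc _).2 _; apply: ler_wpM2l; first exact: ltW.
have I0 : 0 <= induced_norm nrm (word_mx A s) by exact: induced_norm_ge0.
have -> : induced_norm nrm (word_mx A s) = word_rate nrm A s ^+ size s.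
  by rewrite -powR_mulrn ?powR_ge0// -powRrM mulVf ?powRr1// pnatr_eq0 -lt0n.
apply: lerXn2r; rewrite ?nnegrE ?powR_ge0 ?mulr_ge0 ?addr_ge0 ?(ltW r0) ?(ltW e0)//.
have n0s : (n0 <= size s)%N by apply: leq_trans (leqnSn _) (ltnW sn).
apply: le_trans (ltW (hn0 _ n0s)).
exact: (le_bigmax _ (fun t : (size s).-tuple 'I_N => word_rate nrm A t) (in_tuple s)).
Qed.

(** Without the finiteness property the inequality of [spectral_radius_le_rho_d] is strict for every
    nonempty word, so dividing the matrices by [rho_d] brings the eigenvalues of each product into
    the open unit disc. *)
Lemma no_finiteness_cycles_vanish A : 0 < rho_d nrm A -> ~ finiteness_property nrm A ->
  cycles_vanish (fun i => (rho_d nrm A)^-1 *: A i).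
Proof.
set r := rho_d nrm A => r0 nfin s s0; apply: wpow_small => z.
rewrite word_mxZ.
have lt : spectral_radius (word_mx A s) < r ^+ size s.
  case: s s0 => // i s _; set k := size (i :: s); set sp := spectral_radius _.
  have spr : sp `^ k%:R^-1 < r.
    rewrite lt_neqAle (spectral_radius_le_rho_d A (in_tuple (i :: s))) andbT.
    apply/eqP => E; apply: nfin; exists k; split=> //.
    by exists (in_tuple (i :: s)); rewrite -/r -E.
  have [sp0|sp0] := ltP 0 sp; last by apply: le_lt_trans sp0 _; rewrite exprn_gt0.
  have -> : sp = (sp `^ k%:R^-1) ^+ k.
    by rewrite -powR_mulrn ?powR_ge0// -powRrM mulVf ?pnatr_eq0// powRr1// ltW.
  by apply: ltrXn2r => //; rewrite ?nnegrE ?powR_ge0// ltW.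
pose a := (real_complex R r) ^+ size s.
have a0 : a != 0.
  by rewrite expf_neq0//= eq_complex/= eqxx andbT gt_eqF.
have na : ComplexField.Normc.normc a = r ^+ size s.
  by rewrite /a -rmorphXn/= expr0n/= addr0 sqrtr_sqr ger0_norm// exprn_ge0// ltW.
move=> /eigenvalueP[v vz v0].
have : eigenvalue (map_mx (real_complex R) (word_mx A s)) (a * z).
  apply/eigenvalueP; exists v => //; rewrite -scalerA -vz map_mxZ -scalemxAr scalerA.
  by rewrite exprVn fmorphV rmorphXn/= divff// scale1r.
move=> /spectral_radius_ge/le_lt_trans/(_ lt).
by rewrite ComplexField.Normc.normcM na -[ltRHS]mulr1 ltr_pM2l// exprn_gt0.
Qed.

End Assembly.

Theorem corollary4p4 (R : realType) (d N : nat) (d_gt0 : (0 < d)%N)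
    (N_gt0 : (0 < N)%N) (nrm : 'cV[R]_d -> R) (nrmP : is_vector_norm nrm)
    (A : 'I_N -> 'M[R]_d) :
  finiteness_property nrm A <->
  (exists m : nat, (0 < m)%N /\ rho_d nrm A = rho_p nrm m A).
Proof.
split=> [[[|k] [//= _ [t ht]]]|[m [m0 rho_eq]]].
  exists k.+1; split => //.
  set S := [set r | exists nu P, [/\ stochastic_tensor P, probability_tensor nu,
    invariant_tensor nu P & r = rho_p_pair (m := k.+1) nrm nu P A]].
  have ubS : ubound S (rho_d nrm A).
    by move=> _ [nu [P [Pst nuP _ ->]]]; exact: rho_p_pair_le.
  have mem : S (rho_p_pair nrm (cyclic_measure t) cyclic_tensor A).
    exists (cyclic_measure t), cyclic_tensor; split=> //.
    - exact: cyclic_tensor_stochastic.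
    - exact: cyclic_measure_probability.
    - exact: cyclic_measure_invariant.
  apply/eqP; rewrite eq_le; apply/andP; split; last first.
    by apply: ge_sup ubS; eexists; exact: mem.
  rewrite ht; apply: le_trans (spectral_radius_le_rho_p_pair t A nrmP) _.
  by apply: ub_le_sup => //; exists (rho_d nrm A).
have [r0|r0] := leP (rho_d nrm A) 0.
  (* Any word of length 1 realizes a [rho_d] that is not positive: its spectral radius lies between
     0 and [rho_d]. *)
  exists 1%N; split=> //; exists [tuple Ordinal N_gt0].
  apply/eqP; rewrite eq_le (spectral_radius_le_rho_d nrmP) andbT.
  exact: le_trans r0 (powR_ge0 _ _).
apply: contrapT => nfin; pose r := rho_d nrm A.
have [th [K [/andP[th0 th1] K0 hK]]] := mean_vanish_geometric
  (mean_vanish_of_cycles m N_gt0 (rho_d_subexponential nrmP r0)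
    (no_finiteness_cycles_vanish nrmP r0 nfin)).
(* The scaled means are at most [K * th ^+ j], so the original ones are at most [K * (r * th) ^+ j],
   for all chains at once. *)
have : rho_p nrm m A <= r * th.
  have rth : 0 < r * th by exact: mulr_gt0.
  have ubS : ubound [set r | exists nu P, [/\ stochastic_tensor P, probability_tensor nu,
      invariant_tensor nu P & r = rho_p_pair (m := m) nrm nu P A]] (r * th).
    move=> _ [nu [P [Pst nuP _ ->]]].
    apply: (rho_p_pair_le_growth nrmP Pst nuP K0 rth) => u j.
    rewrite exprMn mulrCA -ler_pdivrMl ?exprn_gt0//; apply: le_trans (hK j P u Pst).
    rewrite -expectZ; apply: expect_le => // s <-.
    by rewrite word_mxZ norm1Z exprVn ger0_norm// invr_ge0 exprn_ge0// ltW.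
  (* For an empty set of pairs the supremum is 0, which is below [r * th] as well. *)
  have [S0|/set0P S0] := eqVneq [set r | exists nu P, [/\ stochastic_tensor P,
      probability_tensor nu, invariant_tensor nu P & r = rho_p_pair (m := m) nrm nu P A]] set0.
    by rewrite /rho_p S0 sup0 ltW.
  exact: ge_sup.
by rewrite -rho_eq -/r leNgt => /negP; apply; rewrite gtr_pMr.
Qed.
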